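(* There exists a bidirected necklace grid that does not contain a cyclic necklace grid (as a subgraph).
   Context: $\mathbb N=\{1,2,\dots\}$. Paths in digraphs are finite and directed. An out-ray is a digraph whose underlying undirected graph is a ray (one-way infinite path) and whose edges are all oriented away from its unique vertex of degree $1$, its root. Necklaces. A necklace is a strongly connected (sub)digraph $N$ for which there is a family $(H_\ell)_{\ell\in\mathbb N}$ of finite strongly connected subgraphs of $N$ such that $N=\bigcup_{\ell}H_\ell$ and, for all $\ell,k$, $H_\ell\cap H_k\ne\emptyset$ if and only if $|\ell-k|\le1$. Such a family is a witness of $N$; the interior of $H_\ell$ is $V(H_\ell)\setminus(V(H_{\ell-1})\cup V(H_{\ell+1}))$ for $\ell>1$. Quarter-grids. Let $(R_i)_{i\in\mathbb N}$ be pairwise disjoint out-rays. For a vertex set $X$ let $\lceil X\rceil$ be the union of $X$ and the set of all vertices $v$ lying on some $R_i$ such that the subray of $R_i$ with root $v$ contains a vertex of $X$; for a subgraph $G$ put $\lceil G\rceil:=\lceil V(G)\rceil$. For a sequence $i_1,\dots,i_n$ of indices ($n\ge 2$), a simple $i_1,\dots,i_n$-staircase is a path that is the concatenation of $P_1,Q_2,P_2,Q_3,\dots,Q_{n-1},P_{n-1}$, each consisting of exactly one edge, where $P_j$ is an edge from $R_{i_j}$ to $R_{i_{j+1}}$ and $Q_j$ is an edge of $R_{i_j}$ from the end vertex of $P_{j-1}$ to the start vertex of $P_j$. A digraph $Q=\bigcup_{i\in\mathbb N}R_i\cup\bigcup_{n\ge2}G_n$ is considered, where the digraphs $G_n$ (the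 girders) satisfy: $G_n$ avoids $\lceil G_i\rceil$ for all $2\le i<n$; $Q$ has no vertex whose in-degree and out-degree are both one; the first vertex of each $R_i$ lies in no $G_n$. - $Q$ is a bidirected quarter-grid if, for every $n\ge2$, $G_n$ is the concatenation of a simple $1,2,\dots,n$-staircase $S_n'$, an edge of $R_n$ and a simple $n,n-1,\dots,1$-staircase $S_n''$ such that $S_n''$ avoids $\lceil S_n'\rceil$. - $Q$ is an ascending cyclic quarter-grid if, for every $n\ge 2$, $G_n$ is the concatenation of a simple $1,2,\dots,n$-staircase $S_n$, an edge of $R_n$ and an edge $A_n$ from $R_n$ to $R_1$ such that $A_n$ avoids $\lceil S_n\rceil$. - $Q$ is a descending cyclic quarter-grid if, for every $n\ge2$, $G_n$ is the concatenation of an edge $A_n$ from $R_1$ to $R_n$, an edge of $R_n$ and a simple $n,n-1,\dots,1$-staircase $S_n$ such that $S_n$ avoids $\lceil A_n\rceil$. A cyclic quarter-grid is an ascending or a descending one. The $R_i$ are the vertical rays. In a subdivision, edges are replaced by internally disjoint directed paths of the same orientation; its vertical rays are the rays arising from the $R_i$, and its horizontal paths are the (pairwise disjoint) paths arising from the edges joining distinct vertical rays. Necklace grids. A bidirected (respectively cyclic) necklace grid is obtained from a subdivision of a bidirected (respectively cyclic) quarter-grid by replacing each vertical ray by a necklace. That is, it is the union of pairwise disjoint necklaces $N_i$ ($i\in\mathbb N$; the vertical necklaces), replacing the vertical rays $R_i$, each with a fixed witness $(H_\ell^{N_i})_{\ell\in\mathbb N}$, and pairwise disjoint paths $P'$,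 one for each horizontal path $P$, where if $P$ runs from $R_i$ to $R_j$ then $P'$ is a path from $N_i$ to $N_j$ internally disjoint from all the vertical necklaces, such that for every vertical necklace $N$: (a) for every odd $\ell$ there is at most one edge of the grid that is not in $E(N)$ and has its head or tail in $H_\ell^{N}$; (b) for every even $\ell$ there is no edge of the grid that is not in $E(N)$ and has its head or tail in the interior of $H_\ell^N$; (c) the endpoints of the paths $P'$ occur along $N_i$ in the same order as the endpoints of the paths $P$ along $R_i$: if $x$ precedes $y$ on $R_i$ and $x',y'\in V(N_i)$ are the corresponding endpoints, then $x'\in H^{N_i}_k$ and $y'\in H^{N_i}_\ell$ for some odd $k<\ell$. *)

(* Defs.v *)
From Stdlib Require Relation_Operators.
From mathcomp Require Import all_boot.
From mathcomp Require Import boolp classical_sets cardinality.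

Set Implicit Arguments.
Unset Strict Implicit.
Unset Printing Implicit Defensive.

Local Open Scope classical_set_scope.

(* Families indexed by the positive integers are functions on [nat] whose     *)
(* value at 0 is never used: every index is guarded by [0 < _], which keeps   *)
(* the parities in the definition of necklace grids literal.                  *)

Record digraph (T : Type) := Digraph {
  vert : set T;
  arc : T -> T -> Prop;
  arc_tail : forall x y, arc x y -> vert x;
  arc_head : forall x y, arc x y -> vert y;
  arc_loopless : forall x, ~ arc x x
}.

Definition subgraph (T : Type) (D' D : digraph T) : Prop :=
  vert D' `<=` vert D /\ (forall x y, arc D' x y -> arc D x y).

(* A finite sequence without repetitions is identified with the directed path *)
(* traversing it; these are the edges of that path.                           *)
Definition seq_arc (T : Type) (s : seq T) (x y : T) : Prop :=
  exists s1 s2, s = s1 ++ [:: x, y & s2].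

Definition link (T : Type) (x : T) (m : seq T) (y : T) : seq T :=
  x :: rcons m y.

Definition dipath (T : eqType) (D : digraph T) (x : T) (p : seq T) : Prop :=
  [/\ uniq (x :: p),
      (forall u, u \in x :: p -> vert D u) &
      (forall u v, seq_arc (x :: p) u v -> arc D u v)].

Definition strongly_connected (T : eqType) (D : digraph T) : Prop :=
  forall x y, vert D x -> vert D y -> exists2 p, dipath D x p & last x p = y.

(** Necklaces *)

Record necklace_witness (T : eqType) (N : digraph T) (H : nat -> digraph T)
    : Prop := {
  witness_finite : forall l, 0 < l -> finite_set (vert (H l));
  witness_strong : forall l, 0 < l -> strongly_connected (H l);
  witness_vert : vert N = \bigcup_(l in [set l | 0 < l]) vert (H l);
  witness_arc : forall x y,
    arc N x y <-> exists2 l, 0 < l & arc (H l) x y;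
  witness_meet : forall l k, 0 < l -> 0 < k ->
    (vert (H l) `&` vert (H k) !=set0 <-> (l <= k.+1) && (k <= l.+1))
}.

Definition necklace (T : eqType) (N : digraph T) : Prop :=
  strongly_connected N /\ exists H, necklace_witness N H.

Definition interior (T : eqType) (H : nat -> digraph T) (l : nat) : set T :=
  vert (H l) `\` (vert (H l.-1) `|` vert (H l.+1)).

(** Quarter-grids *)

(* An out-ray is given by the injective enumeration [r] of its vertices from  *)
(* its root [r 0]; a family of out-rays is [R : nat -> nat -> U], where       *)
(* [R i k] is the [k]-th vertex of the [i]-th ray.                            *)
Definition ray_arc (U : Type) (r : nat -> U) (x y : U) : Prop :=
  exists k, x = r k /\ y = r k.+1.

Definition rayclosure (U : Type) (R : nat -> nat -> U) (X : set U) : set U :=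
  X `|` [set v | exists i k m, [/\ 0 < i, v = R i k, k <= m & X (R i m)]].

Inductive staircase (U : Type) (R : nat -> nat -> U) :
    seq nat -> seq U -> Prop :=
| staircase_edge i j s t :
    range (R i) s -> range (R j) t -> staircase R [:: i; j] [:: s; t]
| staircase_step i j I s t s' S :
    range (R i) s -> range (R j) t -> ray_arc (R j) t s' ->
    staircase R (j :: I) (s' :: S) ->
    staircase R [:: i, j & I] [:: s, t, s' & S].

Definition simple_staircase (U : eqType) (R : nat -> nat -> U)
    (I : seq nat) (S : seq U) : Prop :=
  staircase R I S /\ uniq S.

Inductive grid_kind := Bidirected | Ascending | Descending.

(* A simple [n],1-staircase is just an edge from the [n]-th to the first ray, *)
(* so each girder is a staircase, an edge of the [n]-th ray, and a staircase. *)
Definition first_indices (kd : grid_kind) (n : nat) : seq nat :=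
  match kd with
  | Descending => [:: 1; n]
  | _ => iota 1 n
  end.

Definition second_indices (kd : grid_kind) (n : nat) : seq nat :=
  match kd with
  | Ascending => [:: n; 1]
  | _ => rev (iota 1 n)
  end.

Definition girder (U : eqType) (kd : grid_kind) (R : nat -> nat -> U)
    (n : nat) (G : seq U) : Prop :=
  exists S1 x y S2,
    [/\ simple_staircase R (first_indices kd n) (rcons S1 x),
        ray_arc (R n) x y,
        simple_staircase R (second_indices kd n) (y :: S2),
        [set` y :: S2] `&` rayclosure R [set` rcons S1 x] = set0 &
        G = rcons S1 x ++ y :: S2].

Record quarter_grid (U : eqType) (kd : grid_kind) (Q : digraph U)
    (R : nat -> nat -> U) (G : nat -> seq U) : Prop := {
  qg_ray : forall i, 0 < i -> injective (R i);
  qg_ray_disjoint : forall i j, 0 < i -> 0 < j -> i <> j ->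
    range (R i) `&` range (R j) = set0;
  qg_girder : forall n, 2 <= n -> girder kd R n (G n);
  qg_girder_avoid : forall i n, 2 <= i -> i < n ->
    [set` G n] `&` rayclosure R [set` G i] = set0;
  qg_vert : vert Q = \bigcup_(i in [set i | 0 < i]) range (R i)
                     `|` \bigcup_(n in [set n | 2 <= n]) [set` G n];
  qg_arc : forall x y, arc Q x y <->
    (exists2 i, 0 < i & ray_arc (R i) x y)
    \/ (exists2 n, 2 <= n & seq_arc (G n) x y);
  qg_degree : forall v, vert Q v ->
    ~ ((exists! u, arc Q u v) /\ (exists! w, arc Q v w));
  qg_root : forall i n, 0 < i -> 2 <= n -> R i 0 \notin G n
}.

(** Subdivisions *)

(* [f] sends the vertices of [Q] to the branch vertices of [Q'], and the edge *)
(* from [x] to [y] is replaced by the path [link (f x) (m x y) (f y)].        *)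
Record subdivision (U W : eqType) (Q : digraph U) (Q' : digraph W)
    (f : U -> W) (m : U -> U -> seq W) : Prop := {
  sd_inj : forall x y, vert Q x -> vert Q y -> f x = f y -> x = y;
  sd_path : forall x y, arc Q x y -> uniq (link (f x) (m x y) (f y));
  sd_branch : forall x y z, arc Q x y -> vert Q z -> f z \notin m x y;
  sd_disjoint : forall x y x' y' w, arc Q x y -> arc Q x' y' ->
    w \in m x y -> w \in m x' y' -> x = x' /\ y = y';
  sd_vert : forall w, vert Q' w <->
    (exists2 x, vert Q x & w = f x)
    \/ (exists x y, arc Q x y /\ w \in link (f x) (m x y) (f y));
  sd_arc : forall v w, arc Q' v w <->
    exists x y, arc Q x y /\ seq_arc (link (f x) (m x y) (f y)) v w
}.

(* The edges of the vertical ray of the subdivision arising from [r].         *)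
Definition sd_ray_arc (U W : Type) (f : U -> W) (m : U -> U -> seq W)
    (r : nat -> U) (v w : W) : Prop :=
  exists x y, ray_arc r x y /\ seq_arc (link (f x) (m x y) (f y)) v w.

(* [v] strictly precedes [w] on that ray.                                     *)
Definition sd_precedes (U W : Type) (f : U -> W) (m : U -> U -> seq W)
    (r : nat -> U) (v w : W) : Prop :=
  Relation_Operators.clos_trans W (sd_ray_arc f m r) v w.

(** Necklace grids *)

(* The horizontal paths of a subdivision are indexed by these edges of [Q].   *)
Definition horizontal (U : Type) (Q : digraph U) (R : nat -> nat -> U)
    (i j : nat) (a b : U) : Prop :=
  [/\ 0 < i, 0 < j, i <> j, arc Q a b & range (R i) a /\ range (R j) b].

Definition is_horizontal (U : Type) (Q : digraph U) (R : nat -> nat -> U)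
    (a b : U) : Prop :=
  exists i j, horizontal Q R i j a b.

(* The horizontal path arising from the edge from [a] to [b] is replaced by   *)
(* [link (hs a b) (hm a b) (ht a b)]: the endpoint [x] of the former          *)
(* corresponds to the endpoint [x'] of the latter.                            *)
Definition endpoints_correspond (U W T : Type) (Q : digraph U)
    (R : nat -> nat -> U) (f : U -> W) (hs ht : U -> U -> T)
    (x : W) (x' : T) : Prop :=
  exists a b, is_horizontal Q R a b /\
    ((x = f a /\ x' = hs a b) \/ (x = f b /\ x' = ht a b)).

Record necklace_replacement (U W T : eqType)
    (Q : digraph U) (R : nat -> nat -> U) (f : U -> W) (m : U -> U -> seq W)
    (D : digraph T) (N : nat -> digraph T) (H : nat -> nat -> digraph T)
    (hs : U -> U -> T) (hm : U -> U -> seq T) (ht : U -> U -> T) : Prop := {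
  ng_necklace : forall i, 0 < i -> necklace (N i);
  ng_witness : forall i, 0 < i -> necklace_witness (N i) (H i);
  ng_necklace_disjoint : forall i j, 0 < i -> 0 < j -> i <> j ->
    vert (N i) `&` vert (N j) = set0;
  ng_path : forall i j a b, horizontal Q R i j a b ->
    [/\ uniq (link (hs a b) (hm a b) (ht a b)),
        vert (N i) (hs a b),
        vert (N j) (ht a b) &
        forall k z, 0 < k -> z \in hm a b -> ~ vert (N k) z];
  ng_path_disjoint : forall a b a' b' z,
    is_horizontal Q R a b -> is_horizontal Q R a' b' ->
    z \in link (hs a b) (hm a b) (ht a b) ->
    z \in link (hs a' b') (hm a' b') (ht a' b') -> a = a' /\ b = b';
  ng_vert : forall z, vert D z <->
    (exists2 i, 0 < i & vert (N i) z)
    \/ (exists a b, is_horizontal Q R a b /\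
          z \in link (hs a b) (hm a b) (ht a b));
  ng_arc : forall x y, arc D x y <->
    (exists2 i, 0 < i & arc (N i) x y)
    \/ (exists a b, is_horizontal Q R a b /\
          seq_arc (link (hs a b) (hm a b) (ht a b)) x y);
  ng_odd : forall i l x y x' y', 0 < i -> odd l ->
    arc D x y -> ~ arc (N i) x y ->
    vert (H i l) x \/ vert (H i l) y ->
    arc D x' y' -> ~ arc (N i) x' y' ->
    vert (H i l) x' \/ vert (H i l) y' ->
    x = x' /\ y = y';
  ng_even : forall i l x y, 0 < i -> 0 < l -> ~~ odd l ->
    arc D x y -> ~ arc (N i) x y ->
    ~ (interior (H i) l x \/ interior (H i) l y);
  ng_order : forall i x y x' y', 0 < i ->
    endpoints_correspond Q R f hs ht x x' ->
    endpoints_correspond Q R f hs ht y y' ->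
    sd_precedes f m (R i) x y ->
    exists k l, [/\ odd k, odd l, k < l, vert (H i k) x' & vert (H i l) y']
}.

Definition necklace_grid (T : eqType) (kd : grid_kind) (D : digraph T) : Prop :=
  exists (U W : eqType) (Q : digraph U) (R : nat -> nat -> U) (G : nat -> seq U)
         (Q' : digraph W) (f : U -> W) (m : U -> U -> seq W),
    [/\ quarter_grid kd Q R G,
        subdivision Q Q' f m &
        exists (N : nat -> digraph T) (H : nat -> nat -> digraph T)
               (hs : U -> U -> T) (hm : U -> U -> seq T) (ht : U -> U -> T),
          necklace_replacement Q R f m D N H hs hm ht].

Definition bidirected_necklace_grid (T : eqType) (D : digraph T) : Prop :=
  necklace_grid Bidirected D.

Definition cyclic_necklace_grid (T : eqType) (D : digraph T) : Prop :=
  necklace_grid Ascending D \/ necklace_grid Descending D.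

(* Main.v *)
From mathcomp Require Import all_boot zify.
From mathcomp Require Import boolp classical_sets cardinality.
Require Import Defs.

Set Implicit Arguments.
Unset Strict Implicit.
Unset Printing Implicit Defensive.

Local Open Scope classical_set_scope.

(* The example is a subgraph of the grid on nat * nat: its vertical necklaces *)
(* are the columns, with every edge in both directions, and its horizontal    *)
(* paths are single edges at pairwise different heights. Being planar, with   *)
(* all columns going to infinity in the same direction, it contains no cyclic *)
(* necklace grid M, even if orientations are ignored. Indeed, join a vertex of*)
(* M_1 to the left border by a segment B. Choose n < n' such that M_n, M_n'   *)
(* and their links A, A' to M_1 avoid B, and A' meets M_1 later than A. Far   *)
(* out, M_1 is linked to M_2, ..., M_n, and on to M_n', outside B and A'. In a*)
(* large box, the initial part of M_1 with B, a tail of M_1, and M_n' all     *)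
(* reach the border, and each of them is joined to the end of A' in M_1 and to*)
(* M_n: with the exterior of the box as third vertex, this is a K_{3,3}.      *)

(** * Planarity of the grid *)

(** What separates the two kinds of grid is planarity in a quadrant. A cyclic quarter-grid can still
    be drawn in the whole plane, its girders closing up to rings around the beginning of the first
    ray. In a quadrant, however, the beginning of the first necklace can be joined to the border by
    a finite segment, and all but finitely many of the pairwise disjoint rings would have to go
    around that segment, which is impossible.

    The obstruction is made precise by counting crossings mod 2: [theta_planar] is a discrete Jordan
    curve argument, and [box_planar] turns it into the exclusion of a K_{3,3} one of whose vertices
    is the exterior of a box. [no_cyclic_configuration] finds this K_{3,3} using undirected data
    only: consecutive necklaces are linked outside any finite set, and the first necklace is linked
    outside any finite set to arbitrarily late ones. By [girder_arcs] both kinds of cyclic grid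
    supply such links, so [grid_no_cyclic] excludes them from every digraph drawn along the edges of
    the quadrant, and hence from every subgraph of the example.

    For the example, the bidirected quarter-grid is written down in coordinates
    ([quarter_quarter_grid]). The function [level] gives every horizontal edge a height of its own,
    compatible with the order along every ray, so that the rays can be straightened to columns
    ([grid_replacement]). *)

Section Parity.
Variable T : Type.
Implicit Types (e : T -> T -> bool) (a b : T) (p : seq T).

Fixpoint parity e a p : bool :=
  if p is b :: p' then e a b (+) parity e b p' else false.

End Parity.

Lemma parity_off (T : eqType) (e : T -> T -> bool) v a p :
  (forall x y, e x y -> v = x \/ v = y) -> v \notin a :: p ->
  parity e a p = false.
Proof.
move=> ev; elim: p a => //= b p IH a.
rewrite !inE !negb_or => /and3P[va vb vp].
rewrite IH ?inE ?negb_or ?vb // addbF; apply/negP => /ev[] E.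
  by rewrite E eqxx in va.
by rewrite E eqxx in vb.
Qed.

(** * Winding parities of walks *)

Notation cell := (nat * nat)%type.

Definition adj (a b : cell) : bool :=
  (a.1 == b.1) && ((a.2.+1 == b.2) || (b.2.+1 == a.2))
  || (a.2 == b.2) && ((a.1.+1 == b.1) || (b.1.+1 == a.1)).

Lemma adj_sym a b : adj a b = adj b a.
Proof. rewrite /adj; lia. Qed.

Definition vertical (y : nat) (a b : cell) : bool :=
  (a.1 == b.1) && ((a.2 == y) && (b.2 == y.+1) || (b.2 == y) && (a.2 == y.+1)).

Definition vstep (x y : nat) (a b : cell) : bool := (a.1 == x) && vertical y a b.

Definition hstep (x y : nat) (a b : cell) : bool :=
  [&& a.2 == y, b.2 == y & (a.1 == x) && (b.1 == x.+1)
                           || (b.1 == x) && (a.1 == x.+1)].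

Definition cross (x y : nat) (a b : cell) : bool := (a.1 <= x) && vertical y a b.

Definition leftof (x y : nat) (a : cell) : bool := (a.2 == y) && (a.1 <= x).

(* The parity of the number of times the walk crosses the horizontal half-line*)
(* that leaves the unit square with lower left corner [v] to the left.        *)
Definition wind (a : cell) (p : seq cell) (v : cell) : bool :=
  parity (cross v.1 v.2) a p.

(** The half-lines of two squares that are neighbours in a row differ by the vertical edge between
    the squares. *)
Lemma wind_right a p x y :
  wind a p (x.+1, y) = wind a p (x, y) (+) parity (vstep x.+1 y) a p.
Proof.
rewrite /wind /=; elim: p a => //= b p IH a; rewrite IH.
have -> : cross x.+1 y a b = cross x y a b (+) vstep x.+1 y a b.
  rewrite /cross /vstep leq_eqVlt ltnS.
  by case: eqVneq => [->|_]; rewrite ?ltnn ?andbF //= ?addbF.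
by rewrite -!addbA; congr (_ (+) _); rewrite addbCA.
Qed.

Ltac nat_cases :=
  repeat match goal with
  | |- context [@eq_op _ ?a ?b] =>
      let H := fresh in
      first [have H : (a == b) = true by lia | have H : (a == b) = false by lia];
      rewrite H
  | |- context [?a <= ?b] =>
      let H := fresh in
      first [have H : (a <= b) = true by lia | have H : (a <= b) = false by lia];
      rewrite H
  end.

(** Between the two half-lines lies the half-row of vertices described by [leftof]. The edges
    leaving it are those crossing either half-line and the horizontal edge at its right end; a step
    uses one of them exactly if one of its two ends is in the half-row. *)
Lemma cross_up x y a b : adj a b ->
  cross x y.+1 a b = cross x y a b (+) hstep x y.+1 a b
                     (+) leftof x y.+1 a (+) leftof x y.+1 b.
Proof.
case: a b => [a1 a2] [b1 b2]; rewrite /adj /cross /vertical /hstep /leftof /=.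
case/orP=> /andP[/eqP<- /orP[]/eqP<-].
- by case: (ltngtP a2 y) => ?; case: (ltngtP a2 y.+1) => ?;
    case: (leqP a1 x) => ?; nat_cases; try done; lia.
- by case: (ltngtP b2 y) => ?; case: (ltngtP b2 y.+1) => ?;
    case: (leqP a1 x) => ?; nat_cases; try done; lia.
- by case: (ltngtP a2 y.+1) => ?; case: (ltngtP a1 x) => ?; nat_cases; try done; lia.
- by case: (ltngtP a2 y.+1) => ?; case: (ltngtP b1 x) => ?; nat_cases; try done; lia.
Qed.

Lemma wind_up a p x y : path adj a p ->
  wind a p (x, y.+1) = wind a p (x, y) (+) parity (hstep x y.+1) a p
                       (+) leftof x y.+1 a (+) leftof x y.+1 (last a p).
Proof.
rewrite /wind /=; elim: p a => /= [a _|b p IH a /andP[ab bp]].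
  by rewrite addbb.
rewrite (IH b bp).
rewrite (cross_up x y ab).
case: (cross x y a b); case: (hstep _ _ a b); case: (leftof _ _ a);
case: (leftof _ _ b); case: (parity (cross _ _) _ _);
case: (parity (hstep _ _) _ _); case: (leftof _ _ _) => //=.
Qed.

(** * Connections within a set of cells *)

Definition conn (S : set cell) (x y : cell) : Prop :=
  exists p, [/\ path adj x p, last x p = y & forall z, z \in x :: p -> S z].

Lemma conn_refl (S : set cell) x : S x -> conn S x x.
Proof. by move=> Sx; exists [::]; split=> // z; rewrite inE => /eqP->. Qed.

Lemma conn_cons (S : set cell) x y z : S x -> adj x y -> conn S y z -> conn S x z.
Proof.
move=> Sx xy [p [py lp Sp]]; exists (y :: p); split=> //=; first by rewrite xy.
by move=> w; rewrite inE => /predU1P[->|/Sp].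
Qed.

Lemma conn_trans (S : set cell) x y z : conn S x y -> conn S y z -> conn S x z.
Proof.
move=> [p [px lp Sp]] [q [qy lq Sq]]; exists (p ++ q); split.
- by rewrite cat_path px lp.
- by rewrite last_cat lp.
move=> w; rewrite -cat_cons mem_cat => /orP[/Sp//|wq].
by apply: Sq; rewrite inE wq orbT.
Qed.

Lemma conn_sub (S S' : set cell) x y : S `<=` S' -> conn S x y -> conn S' x y.
Proof. by move=> SS' [p [px lp Sp]]; exists p; split=> // z /Sp /SS'. Qed.

Lemma conn_in1 (S : set cell) x y : conn S x y -> S x.
Proof. by case=> p [_ _]; apply; rewrite mem_head. Qed.

Lemma conn_sym (S : set cell) x y : conn S x y -> conn S y x.
Proof.
case=> p [px <- Sp]; elim: p x px Sp => /= [x _ Sx|y' p IH x].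
  by apply: conn_refl; apply: Sx; rewrite mem_head.
case/andP=> xy px Sp; apply: (@conn_trans _ _ y').
  by apply: IH => // z zp; apply: Sp; rewrite inE zp orbT.
apply: (@conn_cons _ _ x); first by apply: Sp; rewrite !inE eqxx orbT.
  by rewrite adj_sym.
by apply: conn_refl; apply: Sp; rewrite mem_head.
Qed.

Lemma conn_in2 (S : set cell) x y : conn S x y -> S y.
Proof. by move/conn_sym/conn_in1. Qed.

Lemma connE (S : set cell) x p : path adj x p ->
  (forall z, z \in x :: p -> S z) -> conn S x (last x p).
Proof. by move=> ? ?; exists p. Qed.

Lemma vstep_from c n : adj c n -> vstep c.1 c.2 c n = (n == (c.1, c.2.+1)).
Proof.
case: c n => [c1 c2] [n1 n2].
rewrite /adj /vstep /vertical xpair_eqE /= eqxx (eq_sym c1) => _.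
by rewrite eqxx /= [X in _ || X]andbC; case: (ltngtP c2 n2) => // ?;
  rewrite ?andbF ?orbF //; nat_cases.
Qed.
Lemma hstep_from c n : adj c n -> hstep c.1 c.2 c n = (n == (c.1.+1, c.2)).
Proof.
case: c n => [c1 c2] [n1 n2]; rewrite /adj /hstep  xpair_eqE /= eqxx => _. lia.
Qed.

(** * The edges around a branch vertex *)

Section Turn.
Variable c : cell.

(** Tells whether the edge from [c] to [m] separates the squares with lower left corners [n] and
    [c]. This happens for [n] to the left and [m] above, and for [n] below and [m] to the right. *)
Definition turn (n m : cell) : bool :=
  (c == (n.1.+1, n.2)) && (m == (c.1, c.2.+1))
  || (c == (n.1, n.2.+1)) && (m == (c.1.+1, c.2)).

Lemma adjP n : adj c n ->
  [\/ n = (c.1, c.2.+1), n = (c.1.+1, c.2), c = (n.1.+1, n.2) | c = (n.1, n.2.+1)].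
Proof.
case: (c) n => [c1 c2] [n1 n2]; rewrite /adj /=.
case/orP=> /andP[/eqP-> /orP[]/eqP<-].
- exact: Or41.
- exact: Or44.
- exact: Or42.
- exact: Or43.
Qed.

Lemma adj_neq n : adj c n -> n != c.
Proof. by apply: contraTneq => ->; case: (c) => c1 c2; rewrite /adj /=; lia. Qed.

Lemma turn_upright n m : n = (c.1, c.2.+1) \/ n = (c.1.+1, c.2) -> turn n m = false.
Proof.
rewrite /turn; case: (c) n => [c1 c2] [n1 n2] /= [] [-> ->]; rewrite !xpair_eqE.
  have [-> ->] : (c1 == c1.+1) = false /\ (c2 == c2.+2) = false by lia.
  by rewrite andbF.
have [-> ->] : (c1 == c1.+2) = false /\ (c1 == c1.+1) = false by lia.
by [].
Qed.

Lemma turn_left n m : c = (n.1.+1, n.2) -> turn n m = (m == (c.1, c.2.+1)).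
Proof.
rewrite /turn; case: (c) n => [c1 c2] [n1 n2] /= [-> ->]; rewrite !xpair_eqE.
have -> : (n1.+1 == n1) = false by lia.
by rewrite !eqxx orbF.
Qed.

Lemma turn_down n m : c = (n.1, n.2.+1) -> turn n m = (m == (c.1.+1, c.2)).
Proof.
rewrite /turn; case: (c) n => [c1 c2] [n1 n2] /= [-> ->]; rewrite !xpair_eqE.
have -> : (n1 == n1.+1) = false by lia.
by rewrite !eqxx.
Qed.

(** Among three of the four directions there is exactly one of the pairs left-up and down-right in
    full, so exactly one of the six terms is true. *)
Lemma turn_sum n1 n2 n3 : adj c n1 -> adj c n2 -> adj c n3 ->
  n1 != n2 -> n1 != n3 -> n2 != n3 ->
  turn n3 n1 (+) turn n3 n2 (+) turn n1 n2 (+) turn n1 n3 (+) turn n2 n1 (+) turn n2 n3.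
Proof.
pose U n := n == (c.1, c.2.+1); pose R n := n == (c.1.+1, c.2).
pose L n := c == (n.1.+1, n.2); pose D n := c == (n.1, n.2.+1).
have flags n : adj c n ->
    [\/ [&& U n, ~~ R n, ~~ L n & ~~ D n], [&& ~~ U n, R n, ~~ L n & ~~ D n],
        [&& ~~ U n, ~~ R n, L n & ~~ D n] | [&& ~~ U n, ~~ R n, ~~ L n & D n]].
  rewrite /U /R /L /D => /adjP; case: (c) n => [c1 c2] [a b] /=.
  case=> -[-> ->]; rewrite !xpair_eqE !eqxx /=;
    [apply: Or41|apply: Or42|apply: Or43|apply: Or44]; lia.
have inj n m : n != m -> [&& ~~ (U n && U m), ~~ (R n && R m),
    ~~ (L n && L m) & ~~ (D n && D m)].
  move=> nm; apply/and4P; split; apply: contraNN nm => /andP[/eqP a /eqP b].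
  - by rewrite a b.
  - by rewrite a b.
  - by move: a; rewrite b => -[]; case: (n) (m) => [? ?] [? ?] /= -> ->.
  - by move: a; rewrite b => -[]; case: (n) (m) => [? ?] [? ?] /= -> ->.
move=> /flags f1 /flags f2 /flags f3 /inj i12 /inj i13 /inj i23.
rewrite /turn -!/(L _) -!/(D _) -!/(U _) -!/(R _).
move: (U n1) (U n2) (U n3) (R n1) (R n2) (R n3) (L n1) (L n2) (L n3) (D n1) (D n2) (D n3)
  f1 f2 f3 i12 i13 i23.
move=> u1 u2 u3 r1 r2 r3 l1 l2 l3 d1 d2 d3.
by case=> /and4P[]; case: u1 r1 l1 d1 => [] [] [] [] //= _ _ _ _;
  case=> /and4P[]; case: u2 r2 l2 d2 => [] [] [] [] //= _ _ _ _;
  case=> /and4P[]; case: u3 r3 l3 d3 => [] [] [] [] //= _ _ _ _.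
Qed.

End Turn.

(** * Theta graphs *)

Section Theta.
Variables (c : cell) (p q : seq cell).
Hypotheses (cp : path adj c p) (cq : path adj c q) (pq : last c p = last c q).

(** The two walks have the same ends, so together they are closed: the corrections for the ends in
    [wind_up] cancel. *)
Definition winds v := wind c p v (+) wind c q v.

Lemma winds_right x y :
  winds (x.+1, y) =
  winds (x, y) (+) (parity (vstep x.+1 y) c p (+) parity (vstep x.+1 y) c q).
Proof.
rewrite /winds !wind_right.
by case: (wind c p _); case: (wind c q _); case: (parity _ c p);
  case: (parity _ c q).
Qed.

Lemma winds_up x y :
  winds (x, y.+1) =
  winds (x, y) (+) (parity (hstep x y.+1) c p (+) parity (hstep x y.+1) c q).
Proof.
rewrite /winds !wind_up // pq.
by case: (wind c p _); case: (wind c q _); case: (parity _ c p);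
  case: (parity _ c q); case: (leftof _ _ c); case: (leftof _ _ (last c q)).
Qed.

Lemma hstep_end x y v : v = (x, y) \/ v = (x.+1, y) ->
  forall a b, hstep x y a b -> v = a \/ v = b.
Proof.
move=> Ev [a1 a2] [b1 b2]; rewrite /hstep /=.
by case/and3P=> /eqP-> /eqP-> /orP[]/andP[/eqP-> /eqP->]; case: Ev; auto.
Qed.

Lemma vstep_end x y v : v = (x, y) \/ v = (x, y.+1) ->
  forall a b, vstep x y a b -> v = a \/ v = b.
Proof.
move=> Ev [a1 a2] [b1 b2]; rewrite /vstep /vertical /=.
by case/and3P=> /eqP-> /eqP<- /orP[]/andP[/eqP-> /eqP->]; case: Ev; auto.
Qed.

(** The squares of two adjacent vertices are separated by an edge incident with the upper or right
    one of them, and walks that avoid this vertex do not use that edge. *)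
Lemma winds_conn S v w : conn S v w ->
  (forall z, S z -> z \notin c :: p /\ z \notin c :: q) -> winds v = winds w.
Proof.
case=> r [vr <- Sr] off; elim: r v vr Sr => //= w' r IH v /andP[vw wr] Sr.
rewrite -IH //; last by move=> z zr; apply: Sr; rewrite inE zr orbT.
have /off[vp vq] : S v by apply: Sr; rewrite mem_head.
have /off[wp wq] : S w' by apply: Sr; rewrite !inE eqxx orbT.
move: vw vp vq wp wq {Sr wr IH}; case: v w' => [v1 v2] [w1 w2]; rewrite /adj /=.
case/orP=> /andP[/eqP<- /orP[]/eqP<-] vp vq wp wq.
- by rewrite winds_up !(parity_off (hstep_end (v := (v1, v2.+1)) _)) ?addbF; auto.
- by rewrite winds_up !(parity_off (hstep_end (v := (v1, w2.+1)) _)) ?addbF; auto.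
- by rewrite winds_right !(parity_off (vstep_end (v := (v1.+1, v2)) _)) ?addbF; auto.
- by rewrite winds_right !(parity_off (vstep_end (v := (w1.+1, v2)) _)) ?addbF; auto.
Qed.

Lemma parity_vstep n r : adj c n -> c \notin n :: r ->
  parity (vstep c.1 c.2) c (n :: r) = (n == (c.1, c.2.+1)).
Proof.
move=> cn cr; rewrite /= (parity_off (vstep_end (v := c) _)) //; last first.
  by left; case: (c).
by rewrite addbF vstep_from.
Qed.

Lemma parity_hstep n r : adj c n -> c \notin n :: r ->
  parity (hstep c.1 c.2) c (n :: r) = (n == (c.1.+1, c.2)).
Proof.
move=> cn cr; rewrite /= (parity_off (hstep_end (v := c) _)) //; last first.
  by left; case: (c).
by rewrite addbF hstep_from.
Qed.

Lemma winds_near n m1 m2 p' q' : adj c n -> p = m1 :: p' -> q = m2 :: q' ->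
  c \notin p -> c \notin q -> n \notin p -> n \notin q ->
  winds n = winds c (+) (turn c n m1 (+) turn c n m2).
Proof.
move=> cn Ep Eq cNp cNq nNp nNq; move: (cp) (cq); rewrite {1}Ep {1}Eq /=.
case/andP=> cm1 _ /andP[cm2 _].
have vE1 : parity (vstep c.1 c.2) c p = (m1 == (c.1, c.2.+1)).
  by rewrite Ep parity_vstep // -Ep.
have hE1 : parity (hstep c.1 c.2) c p = (m1 == (c.1.+1, c.2)).
  by rewrite Ep parity_hstep // -Ep.
have vE2 : parity (vstep c.1 c.2) c q = (m2 == (c.1, c.2.+1)).
  by rewrite Eq parity_vstep // -Eq.
have hE2 : parity (hstep c.1 c.2) c q = (m2 == (c.1.+1, c.2)).
  by rewrite Eq parity_hstep // -Eq.
have nc : n != c.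
  exact: adj_neq.
have {}nNp : n \notin c :: p by rewrite inE negb_or nc.
have {}nNq : n \notin c :: q by rewrite inE negb_or nc.
case: (adjP cn) => E.
- rewrite !turn_upright; auto; rewrite E winds_up addbF -surjective_pairing.
  by rewrite !(parity_off (hstep_end (v := n) _)); auto; rewrite -?E ?addbF.
- rewrite !turn_upright; auto; rewrite E winds_right addbF -surjective_pairing.
  by rewrite !(parity_off (vstep_end (v := n) _)); auto; rewrite -?E ?addbF.
- rewrite !turn_left // (congr1 winds E) winds_right -surjective_pairing.
  have -> : n.1.+1 = c.1 by rewrite E.
  have -> : n.2 = c.2 by rewrite E.
  by rewrite vE1 vE2 -addbA addbb addbF.
- rewrite !turn_down // (congr1 winds E) winds_up -surjective_pairing.
  have -> : n.2.+1 = c.2 by rewrite E.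
  have -> : n.1 = c.1 by rewrite E.
  by rewrite hE1 hE2 -addbA addbb addbF.
Qed.

End Theta.

(* Three walks from [c] to a common end form a theta graph; every vertex has  *)
(* the same sum of winding parities for its three cycles, namely 0. Carrying  *)
(* each of the three parities at [x] to the neighbour of [c] on the third     *)
(* walk and then to [c] itself, the corrections add up to 1.                  *)
Lemma theta_planar c x n1 n2 n3 p1 p2 p3 :
  path adj c (n1 :: p1) -> path adj c (n2 :: p2) -> path adj c (n3 :: p3) ->
  last n1 p1 = last n2 p2 -> last n1 p1 = last n3 p3 ->
  c \notin n1 :: p1 -> c \notin n2 :: p2 -> c \notin n3 :: p3 ->
  conn [set w | w \notin c :: n2 :: p2 /\ w \notin c :: n3 :: p3] x n1 ->
  conn [set w | w \notin c :: n1 :: p1 /\ w \notin c :: n3 :: p3] x n2 ->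
  conn [set w | w \notin c :: n1 :: p1 /\ w \notin c :: n2 :: p2] x n3 ->
  False.
Proof.
move=> cp1 cp2 cp3 l12 l13 N1 N2 N3 r1 r2 r3.
have l23 : last n2 p2 = last n3 p3 by rewrite -l12.
have /andP[a1 _] := cp1; have /andP[a2 _] := cp2; have /andP[a3 _] := cp3.
have [/= n12 n13] := conn_in2 r1; have [/= n21 n23] := conn_in2 r2.
have [/= n31 n32] := conn_in2 r3.
have off (a b : cell) p : a \notin c :: b :: p -> a \notin b :: p.
  by rewrite inE negb_or => /andP[].
have d12 : n1 != n2 by move: n12; rewrite !inE !negb_or => /and3P[].
have d13 : n1 != n3 by move: n13; rewrite !inE !negb_or => /and3P[].
have d23 : n2 != n3 by move: n23; rewrite !inE !negb_or => /and3P[].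
have := winds_conn cp2 cp3 l23 r1 (fun=> id).
rewrite (winds_near cp2 cp3 l23 a1 erefl erefl) //; try exact: off.
have := winds_conn cp1 cp3 l13 r2 (fun=> id).
rewrite (winds_near cp1 cp3 l13 a2 erefl erefl) //; try exact: off.
have := winds_conn cp1 cp2 l12 r3 (fun=> id).
rewrite (winds_near cp1 cp2 l12 a3 erefl erefl) //; try exact: off.
have := turn_sum a1 a2 a3 d12 d13 d23; rewrite /winds.
case: (wind c _ x); case: (wind c _ x); case: (wind c _ x);
case: (wind c _ c); case: (wind c _ c); case: (wind c _ c);
case: (turn c _ _); case: (turn c _ _); case: (turn c _ _);
case: (turn c _ _); case: (turn c _ _); case: (turn c _ _) => //=.
Qed.

(** * Three disjoint legs *)

Section Tripod.
Variables (T : eqType) (e : rel T).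
Hypothesis e_sym : symmetric e.

Lemma first_hit (A : pred T) x p : A (last x p) ->
  exists p1 p2, [/\ p = p1 ++ p2, A (last x p1)
                  & forall z, z \in belast x p1 -> ~~ A z].
Proof.
elim: p x => [|y p IH] x /= Al; first by exists [::], [::].
have [Ax|NAx] := boolP (A x); first by exists [::], (y :: p).
have [p1 [p2 [-> Al1 N1]]] := IH y Al.
exists (y :: p1), p2; split=> // z; rewrite inE => /predU1P[->//|].
exact: N1.
Qed.

Lemma sorted_rev s : sorted e (rev s) = sorted e s.
Proof. by rewrite rev_sorted; apply: eq_sorted => x y; rewrite e_sym. Qed.

(** Shorten both walks to paths and follow the one from [s3] until it first meets the path from [s1]
    to [s2]. The meeting vertex [c] splits that path into two legs; the part travelled so far is the
    third. *)
Lemma tripod (O : pred T) s1 s2 s3 p q :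
  path e s1 p -> last s1 p = s2 -> all O (s1 :: p) ->
  path e s3 q -> last s3 q = s1 -> all O (s3 :: q) ->
  exists c l1 l2 l3,
    [/\ [/\ path e c l1, path e c l2 & path e c l3],
        [/\ last c l1 = s1, last c l2 = s2 & last c l3 = s3],
        uniq (c :: l1 ++ l2 ++ l3) &
        all O (c :: l1 ++ l2 ++ l3)].
Proof.
move=> s1p ls1 Op s3q ls3 Oq.
move: ls1; case/shortenP: s1p => p' s1p' Up' sp' ls1.
have {Op p sp'} Op' : all O (s1 :: p').
  by move: Op => /= /andP[-> /allP Op]; apply/allP => z /sp'/Op.
move: ls3; case/shortenP: s3q => q' s3q' Uq' sq' ls3.
have {Oq q sq'} Oq' : all O (s3 :: q').
  by move: Oq => /= /andP[-> /allP Oq]; apply/allP => z /sq'/Oq.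
have [|q1 [q2 [Eq lq1 Nq1]]] := @first_hit (mem (s1 :: p')) s3 q'.
  by rewrite ls3; apply: mem_head.
move: s3q' Uq' Oq'; rewrite Eq cat_path -cat_cons cat_uniq all_cat.
case/andP=> s3q1 _ /and3P[Uq1 _ _] /andP[Oq1 _].
move: lq1; set c := last s3 q1 => cP.
pose b := belast s3 q1; have Eb : s3 :: q1 = rcons b c by rewrite lastI.
have [pa [pb Epa]] : exists pa pb, s1 :: p' = pa ++ c :: pb.
  by case/splitPr: cP => pa pb; exists pa, pb.
exists c, (rev pa), pb, (rev b).
have srt : sorted e (pa ++ c :: pb) by rewrite -Epa.
have [s1E s2E] : last c (rev pa) = s1 /\ last c pb = s2.
  split; last by rewrite -ls1 -[RHS](last_cons s1 s1) Epa last_cat.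
  by case: pa Epa {srt} => [|a pa] [-> _] //; rewrite rev_cons last_rcons.
split.
- split.
  + rewrite -/(sorted e (c :: rev pa)) -rev_rcons sorted_rev.
    by move: srt; rewrite -cat_rcons => /cat_sorted2[].
  + by move: srt => /cat_sorted2[].
  + rewrite -/(sorted e (c :: rev b)) -rev_rcons sorted_rev -Eb.
    exact: s3q1.
- split=> //; move: Eb; case: (b) => [|a b'] [-> _] //.
  by rewrite rev_cons last_rcons.
- have : uniq (pa ++ c :: pb) by rewrite -Epa.
  have : uniq (rcons b c) by rewrite -Eb.
  have : ~~ has (mem (pa ++ c :: pb)) (rev b).
    rewrite -Epa; apply/hasPn => z; rewrite mem_rev => /Nq1; exact.
  rewrite rcons_uniq => N /andP[cb Ub] U.
  rewrite catA -cat_cons cat_uniq rev_uniq Ub andbT.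
  have pe : perm_eq (c :: rev pa ++ pb) (pa ++ c :: pb).
    by rewrite -cat_cons -cat_rcons perm_cat2r -rev_rcons perm_rev.
  rewrite (perm_uniq pe) U /=; apply/hasPn => z /(hasPn N).
  by rewrite /= (perm_mem pe).
- have : all O (pa ++ c :: pb) by rewrite -Epa.
  have : all O (rcons b c) by rewrite -Eb.
  rewrite /= !all_cat all_rcons !all_rev /=.
  by case/andP=> -> -> /and3P[-> _ ->].
Qed.
End Tripod.

(** * Boxes and the exclusion of K_{3,3} *)

Definition inbox (K : nat) (p : cell) : bool :=
  [&& 0 < p.1, p.1 <= K, 0 < p.2 & p.2 <= K].

Lemma conn_row (S : set cell) x y :
  (forall i, i <= x -> S (i, y)) -> conn S (x, y) (0, y).
Proof.
elim: x => [|x IH] Sx; first exact/conn_refl/Sx.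
apply: (@conn_cons _ _ (x, y)); first exact: Sx.
  by rewrite /adj /= !eqxx !orbT.
by apply: IH => i ix; apply: Sx; rewrite ltnW.
Qed.

Lemma conn_col (S : set cell) x y :
  (forall j, j <= y -> S (x, j)) -> conn S (x, y) (x, 0).
Proof.
elim: y => [|y IH] Sx; first exact/conn_refl/Sx.
apply: (@conn_cons _ _ (x, y)); first exact: Sx.
  by rewrite /adj /= !eqxx !orbT.
by apply: IH => i ix; apply: Sx; rewrite ltnW.
Qed.

(** Row 0 and column 0 lie outside every box. A cell above the box goes left to column 0, one to the
    right of it goes down to row 0. *)
Lemma outside_conn K p : ~~ inbox K p -> conn [set w | ~~ inbox K w] p (0, 0).
Proof.
case: p => x y; rewrite /inbox /= => out.
have [yK|Ky] := leqP y K.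
  have [x0|xN0] := eqVneq x 0.
    by rewrite x0; apply: conn_col.
  have [y0|yN0] := eqVneq y 0.
    by rewrite y0; apply: conn_row => i _; rewrite /= !andbF.
  apply: (@conn_trans _ _ (x, 0)).
    apply: conn_col => j _ /=.
    have -> : (x <= K) = false by lia.
    by rewrite andbF.
  by apply: conn_row => i _; rewrite /= !andbF.
apply: (@conn_trans _ _ (0, y)); last by apply: conn_col => j _ /=.
by apply: conn_row => i _ /=; rewrite (leqNgt y) Ky !andbF.
Qed.

Definition apart (T : Type) (A B : set T) := forall z, A z -> B z -> False.

(** The neighbour [n] of [c] on the walk is reached backwards from the vertex at which [b] is
    attached. It lies on the leg [l], or is [u] if that leg is empty. *)
Lemma leg_conn (c : cell) l u a b : path adj c (l ++ u :: a ++ b) ->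
  exists n p, l ++ u :: a ++ b = n :: p /\
    conn [set z | z \in l \/ z \in u :: a] (last u a) n.
Proof.
have gen r m t : path adj c (m :: t ++ r) ->
    (forall z, z \in m :: t -> z \in l \/ z \in u :: a) -> last m t = last u a ->
    conn [set z | z \in l \/ z \in u :: a] (last u a) m.
  rewrite /= cat_path => /and3P[_ mt _] sub <-; apply: conn_sym.
  exact: connE.
case: l gen => [|n l] gen cp.
  by exists u, (a ++ b); split=> //; apply: (gen b u a cp) => // z; right.
exists n, (l ++ u :: a ++ b); split=> //.
apply: (gen b n (l ++ u :: a)); first by rewrite -catA.
  by move=> z; rewrite -cat_cons mem_cat => /orP; case; auto.
by rewrite last_cat.
Qed.

(* The complement of the box is connected, so it serves, with [x] and [d], as *)
(* the third vertex on one side of a [K_{3,3}]; the sets [N k] and [E k] make *)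
(* up the other side.                                                         *)
Lemma box_planar K d x (N1 N2 N3 E1 E2 E3 R1 R2 R3 : set cell)
    q1 q2 q3 u1 u2 u3 s1 s2 s3 :
  adj u1 s1 -> adj u2 s2 -> adj u3 s3 ->
  ~~ inbox K s1 -> ~~ inbox K s2 -> ~~ inbox K s3 ->
  conn (N1 `&` inbox K) q1 u1 -> conn (N2 `&` inbox K) q2 u2 ->
  conn (N3 `&` inbox K) q3 u3 ->
  conn (E1 `&` inbox K) q1 d -> conn (E2 `&` inbox K) q2 d ->
  conn (E3 `&` inbox K) q3 d ->
  conn (R1 `&` inbox K) x q1 -> conn (R2 `&` inbox K) x q2 ->
  conn (R3 `&` inbox K) x q3 ->
  apart (N1 `|` R1) (N2 `|` E2) -> apart (N1 `|` R1) (N3 `|` E3) ->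
  apart (N2 `|` R2) (N1 `|` E1) -> apart (N2 `|` R2) (N3 `|` E3) ->
  apart (N3 `|` R3) (N1 `|` E1) -> apart (N3 `|` R3) (N2 `|` E2) ->
  False.
Proof.
move=> us1 us2 us3 O1 O2 O3 nq1 nq2 nq3 eq1 eq2 eq3 rq1 rq2 rq3.
move=> A12 A13 A21 A23 A31 A32.
have out s s' : ~~ inbox K s -> ~~ inbox K s' ->
    exists p, [/\ path adj s p, last s p = s' & all (fun w => ~~ inbox K w) (s :: p)].
  move=> Os Os'; have := conn_trans (outside_conn Os) (conn_sym (outside_conn Os')).
  by case=> p [sp lp Op]; exists p; split=> //; apply/allP => z /Op.
have [p [s1p lp Op]] := out _ _ O1 O2.
have [q [s3q lq Oq]] := out _ _ O3 O1.
have [c [l1 [l2 [l3 [[cl1 cl2 cl3] [ls1 ls2 ls3] U O]]]]] :=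
  tripod adj_sym s1p lp Op s3q lq Oq.
have {nq1} [a1 [ua1 la1 Na1]] := conn_sym nq1.
have {nq2} [a2 [ua2 la2 Na2]] := conn_sym nq2.
have {nq3} [a3 [ua3 la3 Na3]] := conn_sym nq3.
case: eq1 => [b1 [qb1 lb1 Eb1]]; case: eq2 => [b2 [qb2 lb2 Eb2]].
case: eq3 => [b3 [qb3 lb3 Eb3]].
(* The three walks of the theta graph: each goes from [c] along a leg outside the box, enters at
   [u], reaches its [q] through [N] and then [d] through [E]. *)
have walk l u a b s qq : path adj c l -> last c l = s -> adj u s -> path adj u a ->
    last u a = qq -> path adj qq b -> path adj c (l ++ u :: a ++ b).
  move=> cl ls us ua la qb.
  by rewrite cat_path cl ls /= adj_sym us /= cat_path ua la qb.
have w1 := walk _ _ _ _ _ _ cl1 ls1 us1 ua1 la1 qb1.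
have w2 := walk _ _ _ _ _ _ cl2 ls2 us2 ua2 la2 qb2.
have w3 := walk _ _ _ _ _ _ cl3 ls3 us3 ua3 la3 qb3.
have inb (N E : set cell) u a b qq z : last u a = qq ->
    (forall z, z \in u :: a -> (N `&` inbox K) z) ->
    (forall z, z \in qq :: b -> (E `&` inbox K) z) ->
    z \in u :: a ++ b -> ((N `|` E) `&` inbox K) z.
  move=> la Na Eb; rewrite -cat_cons mem_cat => /orP[/Na[Nz Bz]|zb].
    by split=> //; left.
  have [Ez Bz] : (E `&` inbox K) z by apply: Eb; rewrite inE zb orbT.
  by split=> //; right.
have i1 := fun z => inb _ _ _ _ _ _ z la1 Na1 Eb1.
have i2 := fun z => inb _ _ _ _ _ _ z la2 Na2 Eb2.
have i3 := fun z => inb _ _ _ _ _ _ z la3 Na3 Eb3.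
(* Outside the box the legs of the tripod are disjoint, inside it [apart] applies, and a vertex
   outside never equals one inside. *)
have off (l l' w' : seq cell) (N R NE : set cell) :
    all (fun w => ~~ inbox K w) (c :: l ++ l') ->
    uniq (c :: l ++ l') -> (forall z, z \in w' -> (NE `&` inbox K) z) ->
    apart (N `|` R) NE ->
    forall z, z \in l \/ ((N `|` R) `&` inbox K) z -> z \notin c :: l' ++ w'.
  move=> /= /andP[Oc Ol] /andP[cN]; rewrite cat_uniq => /and3P[_ ll' _] NEw ap z zl.
  rewrite inE mem_cat !negb_or; case: zl => [zl|[Nz Bz]].
    have Oz : ~~ inbox K z by apply: (allP Ol); rewrite mem_cat zl.
    apply/and3P; split.
    - by apply: contraNneq cN => <-; rewrite mem_cat zl.
    - by apply: contra ll' => zl'; apply/hasP; exists z.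
    - by apply/negP => /NEw[_ Bz]; rewrite Bz in Oz.
  apply/and3P; split.
  - by apply: contraNneq Oc => <-.
  - apply/negP => zl'; suff: ~~ inbox K z by rewrite Bz.
    by apply: (allP Ol); rewrite mem_cat zl' orbT.
  - by apply/negP => /NEw[NEz _]; apply: ap NEz.
have [m1 [r1 [E1' c1]]] := leg_conn w1; have [m2 [r2 [E2' c2]]] := leg_conn w2.
have [m3 [r3 [E3' c3]]] := leg_conn w3.
have subO (l l' : seq cell) : {subset l <= l1 ++ l2 ++ l3} ->
    {subset l' <= l1 ++ l2 ++ l3} ->
    all (fun w => ~~ inbox K w) (c :: l ++ l').
  move=> sl sl'; move: O => /= /andP[-> /allP O]; apply/allP => z.
  by rewrite mem_cat => /orP[/sl/O|/sl'/O].
have s1' : {subset l1 <= l1 ++ l2 ++ l3} by move=> z; rewrite !mem_cat => ->.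
have s2' : {subset l2 <= l1 ++ l2 ++ l3}.
  by move=> z; rewrite !mem_cat => ->; rewrite orbT.
have s3' : {subset l3 <= l1 ++ l2 ++ l3}.
  by move=> z; rewrite !mem_cat => ->; rewrite !orbT.
have [U12 U13 U23] : [/\ uniq (c :: l1 ++ l2), uniq (c :: l1 ++ l3) & uniq (c :: l2 ++ l3)].
  move: U; rewrite /= !mem_cat !negb_or !cat_uniq has_cat negb_or.
  case/andP=> /and3P[-> -> ->] /and3P[-> /andP[-> ->] /and3P[-> -> ->]] //.
have U21 : uniq (c :: l2 ++ l1) by move: U12; rewrite /= !mem_cat orbC uniq_catC.
have U31 : uniq (c :: l3 ++ l1) by move: U13; rewrite /= !mem_cat orbC uniq_catC.
have U32 : uniq (c :: l3 ++ l2) by move: U23; rewrite /= !mem_cat orbC uniq_catC.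
have o12 := off _ _ _ _ _ _ (subO _ _ s1' s2') U12 i2 A12.
have o13 := off _ _ _ _ _ _ (subO _ _ s1' s3') U13 i3 A13.
have o21 := off _ _ _ _ _ _ (subO _ _ s2' s1') U21 i1 A21.
have o23 := off _ _ _ _ _ _ (subO _ _ s2' s3') U23 i3 A23.
have o31 := off _ _ _ _ _ _ (subO _ _ s3' s1') U31 i1 A31.
have o32 := off _ _ _ _ _ _ (subO _ _ s3' s2') U32 i2 A32.
(* The connection from [x] to the neighbour of [c] on a walk: through [R] to [qq], then back along
   the walk through [N] and the leg. *)
have arm (N R S : set cell) (l : seq cell) u a qq n :
    conn (R `&` inbox K) x qq -> last u a = qq ->
    (forall z, z \in u :: a -> (N `&` inbox K) z) ->
    conn [set z | z \in l \/ z \in u :: a] (last u a) n ->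
    (forall z, z \in l \/ ((N `|` R) `&` inbox K) z -> S z) -> conn S x n.
  move=> rq la Na cn sS; apply: (@conn_trans _ _ qq).
    by apply: conn_sub rq => z [Rz Bz]; apply: sS; right; split=> //; right.
  rewrite -la; apply: conn_sub cn => z [zl|/Na[Nz Bz]]; apply: sS; first by left.
  by right; split=> //; left.
have cN (l w : seq cell) (NE : set cell) : uniq (c :: l) ->
    all (fun w => ~~ inbox K w) (c :: l) ->
    (forall z, z \in w -> (NE `&` inbox K) z) -> c \notin l ++ w.
  move=> /andP[cl _] /andP[Oc _] wB; rewrite mem_cat negb_or cl /=.
  by apply/negP => /wB[_ Bc]; rewrite Bc in Oc.
have [N1' N2' N3'] : [/\ c \notin m1 :: r1, c \notin m2 :: r2 & c \notin m3 :: r3].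
  rewrite -E1' -E2' -E3'; split; [apply: cN i1|apply: cN i2|apply: cN i3].
  - by move: U12; rewrite -cat_cons cat_uniq => /and3P[].
  - by move: (subO _ _ s1' s2'); rewrite -cat_cons all_cat => /andP[].
  - by move: U23; rewrite -cat_cons cat_uniq => /and3P[].
  - by move: (subO _ _ s2' s3'); rewrite -cat_cons all_cat => /andP[].
  - by move: U31; rewrite -cat_cons cat_uniq => /and3P[].
  - by move: (subO _ _ s3' s1'); rewrite -cat_cons all_cat => /andP[].
have lastE l u a b qq : last u a = qq -> last c (l ++ u :: a ++ b) = last qq b.
  by move=> <-; rewrite last_cat /= last_cat.
have L1 := lastE l1 u1 a1 b1 q1 la1; have L2 := lastE l2 u2 a2 b2 q2 la2.
have L3 := lastE l3 u3 a3 b3 q3 la3.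
rewrite E1' lb1 /= in L1; rewrite E2' lb2 /= in L2; rewrite E3' lb3 /= in L3.
apply: (@theta_planar c x m1 m2 m3 r1 r2 r3).
- by rewrite -E1'.
- by rewrite -E2'.
- by rewrite -E3'.
- by rewrite L1 L2.
- by rewrite L1 L3.
- exact: N1'.
- exact: N2'.
- exact: N3'.
- apply: (arm _ _ _ _ _ _ _ _ rq1 la1 Na1 c1) => z zz.
  by rewrite -E2' -E3'; split; [apply: o12|apply: o13].
- apply: (arm _ _ _ _ _ _ _ _ rq2 la2 Na2 c2) => z zz.
  by rewrite -E1' -E3'; split; [apply: o21|apply: o23].
- apply: (arm _ _ _ _ _ _ _ _ rq3 la3 Na3 c3) => z zz.
  by rewrite -E1' -E2'; split; [apply: o31|apply: o32].
Qed.

(** * Cyclic configurations in the grid *)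

Definition positive (z : cell) : bool := (0 < z.1) && (0 < z.2).

Lemma conn_inbox (S : set cell) x y : conn S x y -> S `<=` positive ->
  exists K0, forall K, K0 <= K -> conn (S `&` inbox K) x y.
Proof.
case=> p [xp lp Sp] pos; exists (\max_(z <- x :: p) (z.1 + z.2)) => K leK.
exists p; split=> // z zp; have Sz := Sp z zp; split=> //.
have /andP[z1 z2] := pos z Sz.
have : z.1 + z.2 <= K by apply: leq_trans leK; apply: leq_bigmax_seq.
rewrite /inbox z1 z2 /=; move: z.1 z.2; lia.
Qed.

Lemma exit_box (S : set cell) K x y : conn S x y -> inbox K x -> ~~ inbox K y ->
  exists u s, [/\ conn (S `&` inbox K) x u, adj u s & ~~ inbox K s].
Proof.
case=> p [xp <- Sp]; elim: p x xp Sp => [|x' p IH] x /=; first by move=> _ _ ->.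
case/andP=> xx' xp Sp Bx Bl.
have Sx : S x by apply: Sp; rewrite mem_head.
have [Bx'|Bx'] := boolP (inbox K x').
  have [|u [s [x'u us Bs]]] := IH x' xp _ Bx' Bl.
    by move=> z zp; apply: Sp; rewrite inE zp orbT.
  exists u, s; split=> //; apply: (conn_cons _ xx' x'u); by split.
by exists x, x'; split=> //; apply: conn_refl; split.
Qed.

Section CyclicConfiguration.
Variable M : nat -> nat -> set cell.

(** Here [M i l] stands for the vertex set of the [l]-th block of the [i]-th necklace, so [tail i 1]
    is the whole necklace. *)
Definition tail i a : set cell := [set z | exists2 l, a <= l & M i l z].
Definition seg i a b : set cell := [set z | exists2 l, a <= l <= b & M i l z].

(** Orientation is forgotten: [w] joins the two necklaces and meets the family of necklaces only in
    its two ends, whichever way the original path runs. *)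
Definition linked i j (w : seq cell) : Prop :=
  exists x y, [/\ tail i 1 x, tail j 1 y, conn [set` w] x y,
    forall z, z \in w -> positive z &
    forall k z, 0 < k -> z \in w -> tail k 1 z -> (k = i /\ z = x) \/ (k = j /\ z = y)].

Hypothesis M_finite : forall i l, 0 < i -> 0 < l ->
  exists s : seq cell, forall z, M i l z -> z \in s.
Hypothesis M_conn : forall i l u v, 0 < i -> 0 < l ->
  M i l u -> M i l v -> conn (M i l) u v.
Hypothesis M_meet : forall i l k, 0 < i -> 0 < l -> 0 < k ->
  (exists z, M i l z /\ M i k z) <-> (l <= k.+1) && (k <= l.+1).
Hypothesis M_disjoint : forall i j z, 0 < i -> 0 < j ->
  tail i 1 z -> tail j 1 z -> i = j.
Hypothesis M_positive : forall i z, 0 < i -> tail i 1 z -> positive z.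
Hypothesis M_next : forall i (F : seq cell), 0 < i ->
  exists w, linked i i.+1 w /\ forall z, z \in w -> z \notin F.
Hypothesis M_back : forall n0 (F : seq cell),
  exists n w, [/\ n0 <= n, linked 1 n w & forall z, z \in w -> z \notin F].

Lemma tail_sub i a b : a <= b -> tail i b `<=` tail i a.
Proof. by move=> ab z [l bl Mz]; exists l => //; apply: leq_trans bl. Qed.

Lemma seg_tail i a b : seg i a b `<=` tail i a.
Proof. by move=> z [l /andP[al _] Mz]; exists l. Qed.

Lemma tail_seg i a z : tail i 1 z -> ~ seg i 1 a z -> tail i a.+1 z.
Proof.
move=> [l l0 Mz] sz; exists l => //; rewrite ltnNge; apply/negP => la.
by apply: sz; exists l => //; rewrite l0.
Qed.

Lemma seg_sub i a b a' b' : a' <= a -> b <= b' -> seg i a b `<=` seg i a' b'.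
Proof.
move=> aa bb z [l /andP[al lb] Mz]; exists l => //.
by rewrite (leq_trans aa al) (leq_trans lb bb).
Qed.

Lemma seg_conn_le i l d u v : 0 < i -> 0 < l -> M i l u -> M i (l + d) v ->
  conn (seg i l (l + d)) u v.
Proof.
move=> i0 l0 Mu; elim: d v => [|d IH] v Mv.
  rewrite addn0 in Mv *; apply: conn_sub (M_conn i0 l0 Mu Mv) => z Mz.
  by exists l; rewrite // leqnn.
have k0 : 0 < l + d by rewrite addn_gt0 l0.
have [w [Mw Mw']] : exists z, M i (l + d) z /\ M i (l + d.+1) z.
  by apply/M_meet; rewrite ?addnS //; lia.
apply: (@conn_trans _ _ w).
  by apply: conn_sub (IH w Mw); apply: seg_sub; rewrite // addnS.
apply: conn_sub (M_conn i0 _ Mw' Mv); last by rewrite addnS.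
by move=> z Mz; exists (l + d.+1) => //; rewrite leqnn leq_addr.
Qed.

Lemma seg_conn i a b u v : 0 < i -> 0 < a -> seg i a b u -> seg i a b v ->
  conn (seg i a b) u v.
Proof.
move=> i0 a0 [l lab Mu] [l' lab' Mv].
wlog ll' : u v l l' lab lab' Mu Mv / l <= l'.
  move=> H; have [/H|/ltnW/H] := leqP l l'; first exact.
  by move=> {}H; apply: conn_sym; apply: H.
rewrite -(subnKC ll') in Mv; apply: conn_sub (seg_conn_le i0 _ Mu Mv).
  by rewrite subnKC //; apply: seg_sub; case/andP: lab; case/andP: lab'.
by case/andP: lab => /(leq_trans a0).
Qed.

Lemma tail_conn i a u v : 0 < i -> 0 < a -> tail i a u -> tail i a v ->
  conn (tail i a) u v.
Proof.
move=> i0 a0 [l al Mu] [l' al' Mv].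
apply: (@conn_sub (seg i a (maxn l l'))); first exact: seg_tail.
apply: seg_conn => //; [exists l|exists l'] => //.
  by rewrite al leq_maxl.
by rewrite al' leq_maxr.
Qed.

Lemma M_apart i l k z : 0 < i -> 0 < l -> l.+1 < k -> M i l z -> M i k z -> False.
Proof.
move=> i0 l0 lk Ml Mk.
have : (l <= k.+1) && (k <= l.+1) by apply/(M_meet i0 l0 _); [lia|exists z].
by move=> /andP[_]; rewrite leqNgt lk.
Qed.

Lemma M_inhabited i l : 0 < i -> 0 < l -> exists z, M i l z.
Proof.
move=> i0 l0; have [] : exists z, M i l z /\ M i l z.
  by apply/M_meet; rewrite // leqnSn.
by move=> z [Mz _]; exists z.
Qed.

Lemma seg_finite i b : 0 < i -> exists s : seq cell, forall z, seg i 1 b z -> z \in s.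
Proof.
move=> i0; elim: b => [|b [s Hs]].
  by exists [::] => z [l /andP[]]; case: l.
have [s' Hs'] := M_finite i0 (ltn0Sn b).
exists (s ++ s') => z [l /andP[l0 lb] Mz]; rewrite mem_cat.
move: lb; rewrite leq_eqVlt => /predU1P[E|lb]; first by rewrite Hs' ?orbT // -E.
by rewrite Hs //; exists l; rewrite // l0.
Qed.

Lemma tail_avoid i (F : seq cell) : 0 < i ->
  exists2 L, 0 < L & forall z, tail i L z -> z \notin F.
Proof.
move=> i0; elim: F => [|u F [L L0 HL]]; first by exists 1.
have [[l l0 Mu]|Nu] := pselect (tail i 1 u); last first.
  exists L => // z tz; rewrite inE negb_or HL // andbT.
  by apply/eqP => zu; apply: Nu; rewrite -zu; apply: tail_sub tz.
exists (maxn L l.+2); first by rewrite leq_max L0.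
move=> z tz; rewrite inE negb_or; apply/andP; split.
  apply/eqP => zu; case: tz => k; rewrite geq_max => /andP[_ lk]; rewrite zu.
  exact: M_apart Mu.
by apply/HL/tail_sub/tz; rewrite leq_maxl.
Qed.

Lemma necklaces_avoid (F : seq cell) :
  exists n0, forall n z, n0 <= n -> 0 < n -> tail n 1 z -> z \notin F.
Proof.
elim: F => [|u F [n0 Hn0]]; first by exists 0.
have [[i [i0 ti]]|Nu] := pselect (exists i, 0 < i /\ tail i 1 u).
  exists (maxn n0 i.+1) => n z; rewrite geq_max => /andP[n0n ni] np tz.
  rewrite inE negb_or (Hn0 n) // andbT; apply/eqP => zu; rewrite zu in tz.
  by have E := M_disjoint i0 np ti tz; rewrite E ltnn in ni.
exists n0 => n z n0n np tz; rewrite inE negb_or (Hn0 n) // andbT.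
by apply/eqP => zu; apply: Nu; exists n; rewrite -zu.
Qed.

Lemma tail_outside i a K : 0 < i -> exists2 z, tail i a z & ~~ inbox K z.
Proof.
move=> i0; pose F := [seq (x, y) | x <- iota 0 K.+1, y <- iota 0 K.+1].
have [L L0 HL] := tail_avoid F i0; have [z Mz] : exists z, M i (maxn L a) z.
  by apply: M_inhabited; rewrite // leq_max L0.
exists z; first by exists (maxn L a); rewrite // leq_maxr.
have /HL : tail i L z by exists (maxn L a); rewrite // leq_maxl.
apply: contra => /and4P[_ z1 _ z2]; apply/allpairsP; exists z.
by rewrite !mem_iota /= !ltnS z1 z2; case: (z).
Qed.

(** The region where a detour may run: off [F] and off all necklaces except those with index from
    [a] to [b]. *)
Definition clean (F : seq cell) a b : set cell :=
  [set z | [/\ z \notin F, positive z & forall k, 0 < k -> tail k 1 z -> a <= k <= b]].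

Lemma clean_sub F a b a' b' : a' <= a -> b <= b' -> clean F a b `<=` clean F a' b'.
Proof.
move=> aa bb z [zF zp Hz]; split=> // k k0 /(Hz k k0)/andP[ak kb].
by rewrite (leq_trans aa ak) (leq_trans kb bb).
Qed.

Lemma tail_clean F i L : 0 < i -> 0 < L -> (forall z, tail i L z -> z \notin F) ->
  tail i L `<=` clean F i i.
Proof.
move=> i0 L0 HL z tz; have tz1 : tail i 1 z by apply: tail_sub tz.
split; [exact: HL|exact: M_positive tz1|move=> k k0 tk].
by rewrite (M_disjoint k0 i0 tk tz1) leqnn.
Qed.

(** By induction on [d]: the next link is taken to avoid [F] and the initial blocks of both
    necklaces it joins, so that it attaches to tails that avoid [F] and in which one can move
    freely. *)
Lemma chain F i d : 0 < i -> exists L L', [/\ 0 < L, 0 < L' &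
  forall u v, tail i L u -> tail (i + d) L' v -> conn (clean F i (i + d)) u v].
Proof.
move=> i0; elim: d => [|d [L [L1 [L0 L10 IH]]]].
  have [L L0 HL] := tail_avoid F i0; exists L, L; split=> // u v; rewrite addn0.
  move=> tu tv; apply: conn_sub (tail_conn i0 L0 tu tv); exact: tail_clean.
have id0 : 0 < i + d by rewrite addn_gt0 i0.
rewrite addnS; have [L2 L20 HL2] := tail_avoid F (ltn0Sn (i + d)).
have [s1 Hs1] := seg_finite L1 id0; have [s2 Hs2] := seg_finite L2 (ltn0Sn (i + d)).
have [w [[x [y [tx ty xy wp wM]]] wF]] := M_next (F ++ s1 ++ s2) id0.
have wx : x \in w by apply: conn_in1 xy.
have wy : y \in w by apply: conn_in2 xy.
have tx' : tail (i + d) L1 x.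
  apply: (tail_sub (leqnSn L1)); apply: tail_seg tx _ => /Hs1 xs.
  by move: (wF x wx); rewrite !mem_cat xs !orbT.
have ty' : tail (i + d).+1 L2 y.
  apply: (tail_sub (leqnSn L2)); apply: tail_seg ty _ => /Hs2 xs.
  by move: (wF y wy); rewrite !mem_cat xs !orbT.
exists L, L2; split=> // u v tu tv; apply: (@conn_trans _ _ x).
  by apply: conn_sub (IH u x tu tx'); apply: clean_sub.
apply: (@conn_trans _ _ y).
  apply: conn_sub xy => z zw; split; [|exact: wp|move=> k k0 tk].
    by move: (wF z zw); rewrite mem_cat negb_or => /andP[].
  by have [[-> _]|[-> _]] := wM k z k0 zw tk; lia.
apply: conn_sub (tail_conn _ L20 ty' tv) => // z.
move/(tail_clean (ltn0Sn _) L20 HL2); apply: clean_sub => //; lia.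
Qed.

(** One side of the K_{3,3} consists of [a], [z] (early and late on the first necklace) and [q] on
    necklace [n']; the other of [d] on the first necklace between them, [x] on necklace [n], and the
    exterior of a large box. *)
Lemma no_cyclic_configuration : False.
Proof.
have [[p1 p2] Mp] : exists p, M 1 1 p by apply: M_inhabited.
have tp : tail 1 1 (p1, p2) by exists 1.
pose B := [seq (x, p2) | x <- iota 0 p1.+1].
have [LB LB0 HLB] := tail_avoid B (isT : 0 < 1).
have [nB HnB] := necklaces_avoid B.
have [n [wA [nn [a [eA [ta teA aeA wAp wAM]] wAB]]]] := M_back (maxn 3 nB) B.
move: nn; rewrite geq_max => /andP[n3 nBn].
have [la la0 Ma] := ta.
(* Blocks 1 to [m] of the first necklace contain its chosen starting vertex and [a], and from block
   [m] on it avoids [B]. The second link will avoid blocks up to [m.+1], so its end [d] lies in a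
   block disjoint from these. *)
pose m := maxn (maxn 1 LB) la.
have [sm Hsm] := seg_finite m.+1 (isT : 0 < 1).
have [n' [wA' [nn' [d [eA' [td teA' deA' wAp' wAM']] wAB']]]] :=
  M_back n.+1 (B ++ sm ++ wA).
have tdm : tail 1 m.+2 d.
  apply: tail_seg td _ => /Hsm ds.
  by move: (wAB' d (conn_in1 deA')); rewrite !mem_cat ds !orbT.
have [j mj Mj] := tdm.
have [sj Hsj] := seg_finite j.+1 (isT : 0 < 1).
pose F := B ++ sj ++ wA'.
have n20 : 0 < 2 by [].
have n0 : 0 < n by lia.
have n'0 : 0 < n' by lia.
have n1 : 1 < n by lia.
have ne1n : 1 != n by lia.
have ne1n' : 1 != n' by lia.
have nenn' : n != n' by lia.
have tjj : tail 1 j.+2 `<=` tail 1 j by apply: tail_sub; lia.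
have smj : seg 1 1 m `<=` seg 1 1 j by apply: seg_sub => //; lia.
have [L2 [Ln [L20 Ln0 chZ]]] := chain F (n - 2) n20.
have [Ln1 [Ln2 [Ln10 Ln20 chY]]] := chain F (n' - n) n0.
rewrite subnKC // in chZ; rewrite subnKC in chY; last by lia.
have [s2 Hs2] := seg_finite L2 n20.
(* As [F] contains blocks 1 to [j.+1], the link leaves the first necklace at a vertex [z] beyond
   them, in a tail disjoint from all blocks up to [j], and in particular from [d]. *)
have [wL [[z [t [tz tt zt wLp wLM]] wLF]]] := M_next (F ++ s2) (isT : 0 < 1).
have tz' : tail 1 j.+2 z.
  apply: tail_seg tz _ => /Hsj zs.
  by move: (wLF z (conn_in1 zt)); rewrite !mem_cat zs !orbT.
have tt' : tail 2 L2 t.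
  apply: (tail_sub (leqnSn L2)); apply: tail_seg tt _ => /Hs2 ts.
  by move: (wLF t (conn_in2 zt)); rewrite !mem_cat ts !orbT.
have [x Mx] : exists x, M n (maxn Ln Ln1) x.
  by apply: M_inhabited; rewrite // leq_max Ln0.
have [q Mq] : exists q, M n' Ln2 q by apply: M_inhabited.
(* The sets with [N] lead out of the box, those with [E] to [d] and those with [R] to [x]; the
   second letter stands for [a], [z] or [q]. *)
pose NA := [set` B] `|` seg 1 1 m.
pose EA := seg 1 1 j.
pose RA := tail n 1 `|` [set` wA].
pose NZ := tail 1 j.+2.
pose EZ := tail 1 j.
(* On the first necklace this detour may use [z] only, the end of its last link. *)
pose RZ := [set w | [/\ w \notin F, positive w
                      & forall k, 0 < k -> tail k 1 w -> 2 <= k <= n \/ w = z]].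
pose NY := tail n' 1.
pose EY := tail n' 1 `|` [set` wA'].
pose RY := clean F n n'.
have cNA : conn NA a (0, p2).
  apply: (@conn_trans _ _ (p1, p2)).
    apply: (@conn_sub (seg 1 1 m)); first by move=> ?; right.
    apply: seg_conn => //.
      by exists la => //; rewrite la0 leq_maxr.
    by exists 1 => //; rewrite !leq_max.
  apply: (@conn_sub [set` B]); first by move=> ?; left.
  apply: conn_row => i ip; apply/mapP; exists i => //.
  by rewrite mem_iota add0n ltnS.
have tq : tail n' 1 q by exists Ln2.
have tx : tail n 1 x by exists (maxn Ln Ln1); rewrite // leq_max Ln0.
have ma : seg 1 1 m a by exists la => //; rewrite la0 leq_maxr.
have jd : seg 1 j j d by exists j => //; rewrite leqnn.
have j0 : 0 < j by lia.
have cEA : conn EA a d.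
  apply: seg_conn => //; first by apply: seg_sub ma => //; lia.
  by apply: seg_sub jd.
have cEZ : conn EZ z d.
  apply: tail_conn => //; first by apply: tail_sub tz'; lia.
  exact: seg_tail jd.
have cEY : conn EY q d.
  apply: (@conn_trans _ _ eA').
    by apply: conn_sub (tail_conn n'0 _ tq teA') => // ?; left.
  by apply: conn_sym; apply: conn_sub deA' => ?; right.
have cRA : conn RA x a.
  apply: (@conn_trans _ _ eA).
    by apply: conn_sub (tail_conn n0 _ tx teA) => // ?; left.
  by apply: conn_sym; apply: conn_sub aeA => ?; right.
have cRZ : conn RZ x z.
  apply: (@conn_trans _ _ t); apply: conn_sym.
    apply: conn_sub (chZ t x tt' _); last by exists (maxn Ln Ln1); rewrite // leq_maxl.
    by move=> w [wF wp wk]; split=> // k k0 /(wk k k0); left.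
  apply: conn_sub zt => w ww; split; [|exact: wLp|move=> k k0 tk].
    by move: (wLF w ww); rewrite mem_cat negb_or => /andP[].
  by have [[_ ->]|[-> _]] := wLM k w k0 ww tk; [right|left; lia].
have cRY : conn RY x q.
  by apply: chY; [exists (maxn Ln Ln1); rewrite // leq_maxr|exists Ln2].
have tpos i w : 0 < i -> tail i 1 w -> positive w by exact: M_positive.
have [K1 HK1] := conn_inbox cEA (fun w sw => tpos 1 w isT (seg_tail sw)).
have [K2 HK2] : exists K0, forall K, K0 <= K -> conn (EZ `&` inbox K) z d.
  by apply: conn_inbox => // w /(tail_sub j0)/tpos; apply.
have [K3 HK3] : exists K0, forall K, K0 <= K -> conn (EY `&` inbox K) q d.
  by apply: conn_inbox => // w [/tpos|/wAp']; first apply.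
have [K4 HK4] : exists K0, forall K, K0 <= K -> conn (RA `&` inbox K) x a.
  by apply: conn_inbox => // w [/tpos|/wAp]; first apply.
have [K5 HK5] : exists K0, forall K, K0 <= K -> conn (RZ `&` inbox K) x z.
  by apply: conn_inbox => // w [].
have [K6 HK6] : exists K0, forall K, K0 <= K -> conn (RY `&` inbox K) x q.
  by apply: conn_inbox => // w [].
(* A box so large that the six finite connections to [d] and from [x] stay inside; the remaining
   three are followed until they leave it. *)
pose K := maxn (maxn K1 (maxn K2 K3)) (maxn K4 (maxn K5 K6)).
have {}HK1 : conn (EA `&` inbox K) a d by apply: HK1; rewrite !leq_max leqnn.
have {}HK2 : conn (EZ `&` inbox K) z d by apply: HK2; rewrite !leq_max leqnn !orbT.
have {}HK3 : conn (EY `&` inbox K) q d by apply: HK3; rewrite !leq_max leqnn !orbT.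
have {}HK4 : conn (RA `&` inbox K) x a by apply: HK4; rewrite !leq_max leqnn !orbT.
have {}HK5 : conn (RZ `&` inbox K) x z by apply: HK5; rewrite !leq_max leqnn !orbT.
have {}HK6 : conn (RY `&` inbox K) x q by apply: HK6; rewrite !leq_max leqnn !orbT.
have [_ Ba] := conn_in1 HK1; have [_ Bz] := conn_in1 HK2.
have [_ Bq] := conn_in1 HK3.
have [uA [sA [cA usA OA]]] := exit_box cNA Ba isT.
have [z' tz'' Oz] := tail_outside j.+2 K (isT : 0 < 1).
have [uZ [sZ [cZ usZ OZ]]] :=
  exit_box (tail_conn (isT : 0 < 1) (ltn0Sn _) tz' tz'') Bz Oz.
have [q' tq' Oq] := tail_outside 1 K n'0.
have [uY [sY [cY usY OY]]] :=
  exit_box (tail_conn n'0 (isT : 0 < 1) tq tq') Bq Oq.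
have LBj : LB <= j by apply: leq_trans (ltnW (ltnW mj)); rewrite !leq_max leqnn orbT.
have eqT i k w : 0 < i -> 0 < k -> tail i 1 w -> tail k 1 w -> i != k -> False.
  by move=> i0 k0 ti tk /eqP; apply; apply: M_disjoint ti tk.
have B1 w : w \in B -> tail 1 j w -> False.
  by move=> wB /(tail_sub LBj)/HLB; rewrite wB.
have Bn w : w \in B -> tail n 1 w -> False.
  by move=> wB /(HnB n _ nBn n0); rewrite wB.
have Bn' w : w \in B -> tail n' 1 w -> False.
  by move=> wB /(HnB n' _ (leq_trans nBn (ltnW nn')) n'0); rewrite wB.
have BA w : w \in wA -> w \in B -> False by move=> /wAB; case: (w \in B).
have BA' w : w \in wA' -> w \in B -> False.
  by move=> /wAB'; rewrite mem_cat; case: (w \in B).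
have AA' w : w \in wA' -> w \in wA -> False.
  by move=> /wAB'; rewrite !mem_cat; case: (w \in wA); rewrite ?orbT.
have st b c w : b.+1 < c -> seg 1 1 b w -> tail 1 c w -> False.
  move=> bc [l /andP[l0 lb] Ml] [k ck Mk].
  exact: M_apart (isT : 0 < 1) l0 (leq_ltn_trans _ (leq_trans bc ck)) Ml Mk.
have s1 b : seg 1 1 b `<=` tail 1 1 by exact: seg_tail.
have tj1 : tail 1 j `<=` tail 1 1 by exact: tail_sub.
have tjj1 : tail 1 j.+2 `<=` tail 1 1 by apply: tail_sub.
have wA1 w : w \in wA -> tail 1 1 w -> w = a.
  move=> ww tw; have [[_ ->]|[E _]] := wAM 1 w isT ww tw => //.
  by rewrite E eqxx in ne1n.
have wA'1 w : w \in wA' -> tail 1 1 w -> w = d.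
  move=> ww tw; have [[_ ->]|[E _]] := wAM' 1 w isT ww tw => //.
  by rewrite E eqxx in ne1n'.
have wAn' w : w \in wA -> tail n' 1 w -> False.
  move=> ww tw; have [[E _]|[E _]] := wAM n' w n'0 ww tw.
    by rewrite E eqxx in ne1n'.
  by rewrite E eqxx in nenn'.
have wA'n w : w \in wA' -> tail n 1 w -> False.
  move=> ww tw; have [[E _]|[E _]] := wAM' n w n0 ww tw; first by rewrite E eqxx in ne1n.
  by rewrite E eqxx in nenn'.
have aj : tail 1 j a -> False by apply: st ma.
have dm : seg 1 1 m d -> False by move=> sd; apply: (st m m.+2 d).
have dj : tail 1 j.+2 d -> False by apply: (st j) => //; apply: seg_sub jd.
have FB w : w \notin F -> w \in B -> False by rewrite mem_cat; case: (w \in B).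
have Fj w : w \notin F -> seg 1 1 j w -> False.
  move=> wF sw; have /Hsj ws : seg 1 1 j.+1 w by apply: seg_sub sw.
  by move: wF; rewrite !mem_cat ws orbT.
have FA' w : w \notin F -> w \in wA' -> False.
  by move=> wF ww; move: wF; rewrite !mem_cat ww !orbT.
apply: (box_planar usA usZ usY OA OZ OY cA cZ cY HK1 HK2 HK3 HK4 HK5 HK6).
- have NAj w : NA w -> tail 1 j w -> False by case=> [/B1|/st]; apply.
  have RAj w : RA w -> tail 1 j w -> False.
    case=> [tw /tj1 t1|ww tw]; first exact: (eqT _ _ _ _ _ t1 tw).
    by move: (tw); rewrite (wA1 w ww (tj1 _ tw)).
  by move=> w [/NAj|/RAj] H [/tjj|]; apply: H.
- move=> w [[wB|sw]|[tw|ww]] [tw'|[tw'|ww']].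
  + exact: Bn' wB tw'.
  + exact: Bn' wB tw'.
  + exact: BA' ww' wB.
  + exact: (eqT _ _ _ _ _ (s1 _ _ sw) tw').
  + exact: (eqT _ _ _ _ _ (s1 _ _ sw) tw').
  + by move: (sw); rewrite (wA'1 w ww' (s1 _ _ sw)).
  + exact: (eqT _ _ _ _ _ tw tw').
  + exact: (eqT _ _ _ _ _ tw tw').
  + exact: wA'n ww' tw.
  + exact: wAn' ww tw'.
  + exact: wAn' ww tw'.
  + exact: AA' ww' ww.
- have H w : (NZ `|` RZ) w -> w \in B \/ seg 1 1 j w -> False.
    case=> [tw|[wF _ _]] [wB|sw].
    + exact: B1 wB (tjj _ tw).
    + exact: st sw tw.
    + exact: FB wF wB.
    + exact: Fj wF sw.
  by move=> w /H Hw [[wB|/smj sw]|sw]; apply: Hw; auto.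
- have H w : (NZ `|` RZ) w -> tail n' 1 w \/ w \in wA' -> False.
    case=> [tw|[wF _ wk]] [tw'|ww].
    + exact: (eqT _ _ _ _ _ (tjj1 _ tw) tw').
    + by move: (tw); rewrite (wA'1 w ww (tjj1 _ tw)).
    + have [|wz] := wk n' n'0 tw'; first by rewrite (leqNgt n') nn' andbF.
      by rewrite wz in tw'; apply: (eqT _ _ _ _ _ tz tw').
    + exact: FA' wF ww.
  by move=> w /H Hw [tw|[tw|ww]]; apply: Hw; auto.
- move=> w [tw|[wF _ wk]] [[wB|/s1 sw]|/[dup] sj' /s1 sw].
  + exact: Bn' wB tw.
  + exact: (eqT _ _ _ _ _ sw tw).
  + exact: (eqT _ _ _ _ _ sw tw).
  + exact: FB wF wB.
  + by have := wk 1 isT sw; rewrite leqNgt n1.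
  + by have := wk 1 isT sw; rewrite leqNgt n1.
- have H w : (NY `|` RY) w -> tail 1 1 w -> False.
    case=> [tw t1|[_ _ wk] t1]; first exact: (eqT _ _ _ _ _ t1 tw).
    by have := wk 1 isT t1; rewrite leqNgt n1.
  by move=> w /H Hw [/tjj1|/tj1].
Qed.
End CyclicConfiguration.

(** * Links supplied by the girders of a cyclic necklace grid *)

Lemma seq_arc_cons (T : Type) (a : T) s x y : seq_arc s x y -> seq_arc (a :: s) x y.
Proof. by case=> s1 [s2 ->]; exists (a :: s1), s2. Qed.

Lemma seq_arc_cat (T : Type) (r s t : seq T) x y :
  seq_arc s x y -> seq_arc (r ++ s ++ t) x y.
Proof. by case=> s1 [s2 ->]; exists (r ++ s1), (s2 ++ t); rewrite -!catA. Qed.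

Lemma seq_arc_mem (T : eqType) (s : seq T) x y : seq_arc s x y -> x \in s.
Proof. by case=> s1 [s2 ->]; rewrite mem_cat mem_head orbT. Qed.

Lemma seq_arc_path (T : eqType) (e : rel T) x p :
  (forall u v, seq_arc (x :: p) u v -> e u v) -> path e x p.
Proof.
elim: p x => //= y p IH x xe; rewrite xe; last by exists [::], p.
by apply: IH => u v /(seq_arc_cons x)/xe.
Qed.

Lemma staircase_arc (U : Type) (R : nat -> nat -> U) I S : staircase R I S ->
  forall I1 i j I2, I = I1 ++ [:: i, j & I2] ->
  exists s t, [/\ seq_arc S s t, range (R i) s & range (R j) t].
Proof.
elim=> {I S} [i j s t Rs Rt|i j I s t s' S Rs Rt ts' _ IH] I1 i' j' I2.
  case: I1 => [|? [|? []]] // [<- <- _].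
  by exists s, t; split=> //; exists [::], [::].
case: I1 => [[<- <- _]|? I1 [_ /IH[a [b [ab Ra Rb]]]]].
  by exists s, t; split=> //; exists [::], (s' :: S).
by exists a, b; split=> //; do 2 apply: seq_arc_cons.
Qed.

Section NoCyclicGrid.
Variables (U : eqType) (kd : grid_kind) (Q : digraph U) (R : nat -> nat -> U).
Variable G : nat -> seq U.
Hypotheses (kdC : kd <> Bidirected) (QG : quarter_grid kd Q R G).

(** The shortcut between the first and the [n]-th ray is the short staircase of the girder, the
    other links are edges of its long one. Ascending and descending grids differ only in the
    direction of these edges, left open here. *)
Lemma girder_arcs n : 2 <= n ->
  (exists s t, seq_arc (G n) s t /\
     (range (R 1) s /\ range (R n) t \/ range (R n) s /\ range (R 1) t))
  /\ forall i, 0 < i -> i < n ->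
     exists s t, seq_arc (G n) s t /\
     (range (R i) s /\ range (R i.+1) t \/ range (R i.+1) s /\ range (R i) t).
Proof.
move=> n2; have [S1 [x [y [S2 [[st1 _] _ [st2 _] _ ->]]]]] := qg_girder QG n2.
have left_arc s t : seq_arc (rcons S1 x) s t -> seq_arc (rcons S1 x ++ y :: S2) s t.
  by move/(seq_arc_cat [::] (y :: S2)).
have right_arc s t : seq_arc (y :: S2) s t -> seq_arc (rcons S1 x ++ y :: S2) s t.
  by move/(seq_arc_cat (rcons S1 x) [::]); rewrite cats0.
have iotaE i : 0 < i -> i < n ->
    iota 1 n = iota 1 i.-1 ++ [:: i, i.+1 & iota i.+2 (n - i.+1)].
  move=> i0 lin; have -> : n = i.-1 + (2 + (n - i.+1)) by lia.
  rewrite iotaD add1n prednK //; congr (_ ++ [:: _, _ & iota _ _]); lia.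
have revE i : 0 < i -> i < n ->
    rev (iota 1 n) = rev (iota i.+2 (n - i.+1)) ++ [:: i.+1, i & rev (iota 1 i.-1)].
  move=> i0 /(iotaE i i0)->; rewrite rev_cat !rev_cons -!cats1 -!catA //.
move: st1 st2; case: kd kdC => // _ /= st1 st2; split.
- have [s [t [st Rs Rt]]] := staircase_arc st2 (I1 := [::]) (erefl _).
  by exists s, t; split; [exact: right_arc|right].
- move=> i i0 lin; have [s [t [st Rs Rt]]] := staircase_arc st1 (iotaE i i0 lin).
  by exists s, t; split; [exact: left_arc|left].
- have [s [t [st Rs Rt]]] := staircase_arc st1 (I1 := [::]) (erefl _).
  by exists s, t; split; [exact: left_arc|left].
- move=> i i0 lin; have [s [t [st Rs Rt]]] := staircase_arc st2 (revE i i0 lin).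
  by exists s, t; split; [exact: right_arc|right].
Qed.

Lemma girder_disjoint n n' z : 2 <= n -> 2 <= n' -> z \in G n -> z \in G n' -> n = n'.
Proof.
move=> n2 n'2; have avoid i k : 2 <= i -> i < k -> z \in G i -> z \in G k -> False.
  move=> i2 ik zi zk; have := qg_girder_avoid QG i2 ik.
  by move/seteqP => [/(_ z) + _]; apply; split=> //; left.
by move=> zn zn'; case: (ltngtP n n') => // H; case: (avoid _ _ _ H).
Qed.

Variables (W : eqType) (f : U -> W) (m : U -> U -> seq W) (D : digraph cell).
Variables (N : nat -> digraph cell) (H : nat -> nat -> digraph cell).
Variables (hs : U -> U -> cell) (hm : U -> U -> seq cell) (ht : U -> U -> cell).
Hypothesis DN : necklace_replacement Q R f m D N H hs hm ht.
Hypothesis D_adj : forall x y, arc D x y -> adj x y.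
Hypothesis D_positive : forall z, vert D z -> positive z.

Let M i l := vert (H i l).

Lemma tailE i : 0 < i -> tail M i 1 = vert (N i).
Proof. by move=> i0; rewrite (witness_vert (ng_witness DN i0)). Qed.

Lemma linked_sym i j w : linked M i j w -> linked M j i w.
Proof.
case=> x [y [tx ty xy wp wM]]; exists y, x; split=> //; first exact: conn_sym.
by move=> k z k0 zw tk; case: (wM k z k0 zw tk); auto.
Qed.

Lemma necklace_unique i j z : 0 < i -> 0 < j -> vert (N i) z -> vert (N j) z -> i = j.
Proof.
move=> i0 j0 Ni Nj; have [//|/eqP ij] := eqVneq i j.
by have /seteqP[/(_ z) + _] := ng_necklace_disjoint DN i0 j0 ij; case.
Qed.

Lemma horizontal_linked i j a b : horizontal Q R i j a b ->
  linked M i j (link (hs a b) (hm a b) (ht a b)).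
Proof.
move=> hab; have [i0 j0 _ _ _] := hab.
have isab : is_horizontal Q R a b by exists i, j.
have [Uw Ns Nt Nm] := ng_path DN hab.
exists (hs a b), (ht a b); rewrite !tailE //; split=> //.
- exists (rcons (hm a b) (ht a b)); rewrite last_rcons; split=> //.
  apply: seq_arc_path => u v uv; apply/D_adj/(ng_arc DN); right.
  by exists a, b.
- move=> z zw; apply/D_positive/(ng_vert DN); right.
  by exists a, b.
- move=> k z k0; rewrite tailE // inE mem_rcons inE => /or3P[/eqP->|/eqP->|].
  + by left; split=> //; apply: necklace_unique Ns.
  + by right; split=> //; apply: necklace_unique Nt.
  + by move/(Nm k z k0).
Qed.

Lemma horizontal_avoid (F : seq cell) : exists n0, forall n a b z,
  n0 <= n -> 2 <= n -> a \in G n -> is_horizontal Q R a b ->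
  z \in link (hs a b) (hm a b) (ht a b) -> z \notin F.
Proof.
elim: F => [|u F [n0 Hn0]]; first by exists 0.
have [[n [a [b [n2 Ga ab uab]]]]|Nu] := pselect (exists n a b,
    [/\ 2 <= n, a \in G n, is_horizontal Q R a b
       & u \in link (hs a b) (hm a b) (ht a b)]).
  exists (maxn n0 n.+1) => n' a' b' z; rewrite geq_max => /andP[n0n nn] n'2 Ga' ab' zab.
  rewrite inE negb_or (Hn0 n' a' b') // andbT; apply/eqP => zu; rewrite zu in zab.
  have [Ea _] := ng_path_disjoint DN ab ab' uab zab; rewrite -Ea in Ga'.
  by have En := girder_disjoint n2 n'2 Ga Ga'; rewrite En ltnn in nn.
exists n0 => n a b z n0n n2 Ga ab zab; rewrite inE negb_or (Hn0 n a b) // andbT.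
by apply/eqP => zu; apply: Nu; exists n, a, b; rewrite -zu.
Qed.

Lemma girder_linked n i j s t : 2 <= n -> 0 < i -> 0 < j -> i <> j ->
  seq_arc (G n) s t ->
  range (R i) s /\ range (R j) t \/ range (R j) s /\ range (R i) t ->
  is_horizontal Q R s t /\ linked M i j (link (hs s t) (hm s t) (ht s t)).
Proof.
move=> n2 i0 j0 ij st.
have Qst : arc Q s t by apply/(qg_arc QG); right; exists n.
case=> -[Rs Rt].
  have h : horizontal Q R i j s t by [].
  by split; [exists i, j|apply: horizontal_linked].
have h : horizontal Q R j i s t by split=> //; apply/nesym.
by split; [exists j, i|apply: linked_sym; apply: horizontal_linked].
Qed.

Lemma cyclic_grid_absurd : False.
Proof.
apply: (@no_cyclic_configuration M).
- move=> i l i0 l0; have /finite_seqP[s E] := witness_finite (ng_witness DN i0) l0.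
  by exists s => z; rewrite /M E.
- move=> i l u v i0 l0 Mu Mv.
  have [p [_ pV pA] <-] := witness_strong (ng_witness DN i0) l0 Mu Mv.
  exists p; split=> //; apply: seq_arc_path => a b /pA ab.
  apply/D_adj/(ng_arc DN); left; exists i => //.
  by apply/(witness_arc (ng_witness DN i0)); exists l.
- move=> i l k i0 l0 k0; rewrite -(witness_meet (ng_witness DN i0) l0 k0).
  by split=> [[z [? ?]]|[z [? ?]]]; exists z.
- by move=> i j z i0 j0; rewrite !tailE //; apply: necklace_unique.
- move=> i z i0; rewrite tailE // => Nz; apply/D_positive/(ng_vert DN).
  by left; exists i.
- move=> i F i0; have [n0 Hn0] := horizontal_avoid F.
  pose n := maxn n0 i.+1.
  have n2 : 2 <= n by rewrite leq_max ltnS i0 orbT.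
  have [_ /(_ i i0)[]] := girder_arcs n2; first by rewrite leq_max leqnn orbT.
  move=> s [t [st Rst]].
  have [hst lst] := girder_linked n2 i0 (ltn0Sn i) (@n_Sn i) st Rst.
  exists (link (hs s t) (hm s t) (ht s t)); split=> // z.
  by apply: (Hn0 n) => //; [rewrite leq_maxl|apply: seq_arc_mem st].
- move=> n1 F; have [n0 Hn0] := horizontal_avoid F.
  pose n := maxn 2 (maxn n0 n1).
  have n2 : 2 <= n by rewrite leq_max.
  have [[s [t [st Rst]]] _] := girder_arcs n2.
  have [hst lst] : is_horizontal Q R s t /\
      linked M 1 n (link (hs s t) (hm s t) (ht s t)).
    by apply: (girder_linked n2 _ _ _ st) => //; lia.
  exists n, (link (hs s t) (hm s t) (ht s t)); split=> //.
    by rewrite !leq_max leqnn !orbT.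
  by move=> z; apply: (Hn0 n) => //; [rewrite !leq_max leqnn !orbT|apply: seq_arc_mem st].
Qed.
End NoCyclicGrid.

(** Both hypotheses pass to subgraphs, so this also covers all subgraphs of the example. *)
Theorem grid_no_cyclic (D : digraph cell) :
  (forall x y, arc D x y -> adj x y) -> (forall z, vert D z -> positive z) ->
  ~ cyclic_necklace_grid D.
Proof.
by move=> Da Dp [] [U [W [Q [R [G [Q' [f [m [QG _ [N [H [hs [hm [ht DN]]]]]]]]]]]]]];
  apply: (cyclic_grid_absurd _ QG DN Da Dp).
Qed.

(** * The bidirected quarter-grid *)

(* The vertex [(n, e)] with [n >= 2] and [e < 4 n - 4] is the [e]-th vertex of*)
(* the [n]-th girder, whose [c]-th horizontal edge joins the vertices [2 c]   *)
(* and [2 c + 1] and leads from the ray [col n c] to the ray [col n c.+1].    *)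
(* The root of the [i]-th ray is [(0, i)].                                    *)
Definition col (n c : nat) : nat := minn c.+1 (2 * n - 1 - c).

(** The girder containing the [k]-th vertex of ray [i], for positive [k]. Ray 1 meets each girder
    twice, starting with girder 2. A ray [i > 1] meets girder [i], where the girder turns around,
    twice and every later one four times; counting from [k.+1] makes up for the two visits missing
    in girder [i]. *)
Definition ray_girder (i k : nat) : nat :=
  if i == 1 then k.+3 %/ 2 else i + k.+1 %/ 4.

(** For [i > 1] the four values are the arrival at and departure from ray [i], on the first and then
    on the second staircase. The default value of [nth] is the fourth, for residue 3. *)
Definition ray_rank (i k : nat) : nat :=
  let n := ray_girder i k in
  if i == 1 then (if odd k then 0 else 4 * n - 5)
  else nth (4 * n - 2 * i - 2) [:: 2 * i - 3; 2 * i - 2; 4 * n - 2 * i - 3] (k.+1 %% 4).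

Definition ray (i k : nat) : nat * nat :=
  if k is 0 then (0, i) else (ray_girder i k, ray_rank i k).

Lemma ray_rankE i k : 1 < i ->
  let n := ray_girder i k in
  [\/ k.+1 = 4 * (n - i) /\ ray_rank i k = 2 * i - 3,
      k.+1 = 4 * (n - i) + 1 /\ ray_rank i k = 2 * i - 2,
      k.+1 = 4 * (n - i) + 2 /\ ray_rank i k = 4 * n - 2 * i - 3 |
      k.+1 = 4 * (n - i) + 3 /\ ray_rank i k = 4 * n - 2 * i - 2].
Proof.
move=> i1; rewrite /ray_rank /ray_girder; have -> : (i == 1) = false by lia.
have := ltn_pmod k.+1 (isT : 0 < 4); have := divn_eq k.+1 4.
set q := k.+1 %/ 4; set r := k.+1 %% 4.
case: r => [|[|[|[|//]]]] /= Ek _; [apply: Or41|apply: Or42|apply: Or43|apply: Or44]; lia.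
Qed.

Lemma ray1E k : 0 < k -> let n := ray_girder 1 k in
  k = 2 * n - 3 /\ ray_rank 1 k = 0 /\ 2 <= n \/
  k = 2 * n - 2 /\ ray_rank 1 k = 4 * n - 5 /\ 2 <= n.
Proof.
move=> k0; rewrite /ray_rank /ray_girder /=.
have [ok|ek] := boolP (odd k); [left|right]; lia.
Qed.

Lemma ray_girder_ge i k : 1 < i -> i <= ray_girder i k.
Proof. by move=> i1; rewrite /ray_girder gtn_eqF // leq_addr. Qed.

Lemma ray_vertex i k : 0 < i -> 0 < k -> let n := ray_girder i k in
  let e := ray_rank i k in [/\ 2 <= n, e < 4 * n - 4 & col n (uphalf e) = i].
Proof.
move=> i0 k0 /=; have [->|i1] := eqVneq i 1.
  by have /= [[_ [-> n2]]|[_ [-> n2]]] := ray1E k0; rewrite /col; split; lia.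
have {i0} i1 : 1 < i by lia.
have := ray_girder_ge k i1; have /= := ray_rankE k i1; rewrite /col.
set n := ray_girder i k; set e := ray_rank i k.
by case=> -[Ek ->] ni; split; lia.
Qed.

Lemma ray_eq i k n r : 1 < i -> i <= n -> 0 < k -> r < 4 -> k.+1 = 4 * (n - i) + r ->
  ray i k = (n, nth (4 * n - 2 * i - 2) [:: 2 * i - 3; 2 * i - 2; 4 * n - 2 * i - 3] r).
Proof.
case: k => // k i1 ni _ r4 Ek; rewrite /ray /ray_rank.
have -> : ray_girder i k.+1 = n.
  by rewrite /ray_girder gtn_eqF // Ek mulnC divnMDl // (divn_small r4) addn0 subnKC.
by rewrite gtn_eqF // Ek (mulnC 4 (n - i)) modnMDl (modn_small r4).
Qed.

Lemma ray_eq1 n : 2 <= n ->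
  ray 1 (2 * n - 3) = (n, 0) /\ ray 1 (2 * n - 2) = (n, 4 * n - 5).
Proof.
move=> n2; have [k ->] : exists k, n = k + 2 by exists (n - 2); lia.
have -> : 2 * (k + 2) - 3 = (2 * k).+1 by lia.
have -> : 2 * (k + 2) - 2 = (2 * k).+2 by lia.
rewrite /ray /ray_rank /ray_girder /=.
have -> : odd (2 * k) = false by lia.
by split=> /=; congr pair; lia.
Qed.

(** The last clause yields the vertical edges of the girder: a horizontal edge ends in a vertex of
    odd rank, and the next vertex of its ray is the one where the girder leaves again. *)
Lemma ray_surj n e : 2 <= n -> e < 4 * n - 4 -> exists k, [/\ 0 < k,
  ray (col n (uphalf e)) k = (n, e) &
  odd e -> e.+1 < 4 * n - 4 -> ray (col n (uphalf e)) k.+1 = (n, e.+1)].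
Proof.
move=> n2 en; have [r0 r1] := ray_eq1 n2.
have [e0|e0] := eqVneq e 0.
  exists (2 * n - 3); rewrite e0; split=> //; first lia.
  by rewrite /col -r0; congr ray; lia.
have [e1|e1] := eqVneq e (4 * n - 5).
  exists (2 * n - 2); split; [lia| |lia].
  by rewrite e1 -r1; congr ray; rewrite /col; lia.
have [c Ec] : exists c, e = 2 * c \/ e = (2 * c).+1.
  by exists (e %/ 2); lia.
(* Ranks below [2 * n - 3] belong to the first visit of the ray, with [k.+1] congruent to 0 or 1 mod
   4; the remaining ones, which include both vertices on ray [n], to residues 2 and 3. *)
have [lt|ge] := ltnP e (2 * n - 3).
  exists (if odd e then 4 * (n - col n (uphalf e)) - 1 else 4 * (n - col n (uphalf e))).
  case: Ec => Ec.
    have -> : odd e = false by lia.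
    have Ei : col n (uphalf e) = c.+1 by rewrite /col; lia.
    rewrite Ei; split=> //; first lia.
    by rewrite (@ray_eq _ _ n 1) //=; [congr pair|..]; lia.
  have -> : odd e = true by lia.
  have Ei : col n (uphalf e) = c.+2 by rewrite /col; lia.
  rewrite Ei; split=> [||_ _]; first lia.
    by rewrite (@ray_eq _ _ n 0) //=; [congr pair|..]; lia.
  by rewrite (@ray_eq _ _ n 1) //=; [congr pair|..]; lia.
exists (if odd e then 4 * (n - col n (uphalf e)) + 1 else 4 * (n - col n (uphalf e)) + 2).
case: Ec => Ec.
  have -> : odd e = false by lia.
  have Ei : col n (uphalf e) = 2 * n - 1 - c by rewrite /col; lia.
  rewrite Ei; split=> //; first lia.
  by rewrite (@ray_eq _ _ n 3) //=; [congr pair|..]; lia.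
have -> : odd e = true by lia.
have Ei : col n (uphalf e) = 2 * n - 2 - c by rewrite /col; lia.
rewrite Ei; split=> [||_ _]; first lia.
  by rewrite (@ray_eq _ _ n 2) //=; [congr pair|..]; lia.
by rewrite (@ray_eq _ _ n 3) //=; [congr pair|..]; lia.
Qed.

(** Both ends of a horizontal edge have the same level, distinct horizontal edges have distinct
    levels, as girder [n] stays below the next square, and levels increase along each ray after its
    root. Thus the level serves as height in the drawing and as a measure of order in the
    quarter-grid. *)
Definition level (v : nat * nat) : nat := v.1 * v.1 + v.2 %/ 2.

Lemma level_inj n n' c c' : c < 2 * n + 1 -> c' < 2 * n' + 1 ->
  n * n + c = n' * n' + c' -> n = n' /\ c = c'.
Proof.
have lt a b x y : x < 2 * a + 1 -> a < b -> a * a + x < b * b + y.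
  by move=> xa ab; have := leq_mul ab ab; rewrite mulSn mulnS; lia.
move=> cn cn' E; case: (ltngtP n n') => [/(lt _ _ c c' cn)|/(lt _ _ c' c cn')|nn'].
- by rewrite E ltnn.
- by rewrite E ltnn.
- by split=> //; move: E; rewrite nn' => /addnI.
Qed.

Lemma level_rayS i k : 0 < i -> 0 < k -> level (ray i k) < level (ray i k.+1).
Proof.
move=> i0 k0; have -> : ray i k = (ray_girder i k, ray_rank i k) by case: k k0.
rewrite /level /=; have next n n' e e' :
    n' = n /\ e %/ 2 < e' %/ 2 \/ n' = n.+1 /\ e %/ 2 <= 2 * n ->
    n * n + e %/ 2 < n' * n' + e' %/ 2.
  by case=> -[-> H]; [lia|nia].
apply: next; have [->|i1] := eqVneq i 1.
  have /= := ray1E k0; have /= := ray1E (ltn0Sn k).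
  set n := ray_girder 1 k; set n' := ray_girder 1 k.+1.
  by case=> -[Ek' [-> n'2]] [] [Ek [-> n2]]; lia.
have {}i1 : 1 < i by lia.
have := ray_girder_ge k i1; have := ray_girder_ge k.+1 i1.
have /= := ray_rankE k i1; have /= := ray_rankE k.+1 i1.
set n := ray_girder i k; set n' := ray_girder i k.+1.
by case=> -[Ek' ->] [] [Ek ->] n'i ni; lia.
Qed.

Lemma level_ray i k k' : 0 < i -> 0 < k -> k < k' -> level (ray i k) < level (ray i k').
Proof.
move=> i0 k0; elim: k' => // k' IH; rewrite ltnS leq_eqVlt => /predU1P[<-|kk'].
  exact: level_rayS.
by apply: ltn_trans (IH kk') (level_rayS i0 _); apply: ltn_trans kk'.
Qed.

Lemma ray_inj i : 0 < i -> injective (ray i).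
Proof.
move=> i0; suff lt k k' : k < k' -> ray i k <> ray i k'.
  by move=> k k' E; case: (ltngtP k k') => // /lt; rewrite E.
case: k => [|k] kk' E; last by have := level_ray i0 (ltn0Sn k) kk'; rewrite E ltnn.
have [n2 _ _] := ray_vertex i0 kk'.
by case: k' kk' E n2 => // k' _ [<-].
Qed.

Lemma ray_col i k n e : 0 < i -> ray i k = (n, e) -> 2 <= n ->
  [/\ 0 < k, e < 4 * n - 4 & col n (uphalf e) = i].
Proof.
case: k => [|k] i0 [<- <-] // _.
by have [] := ray_vertex i0 (ltn0Sn k).
Qed.

Lemma ray_disjoint i j k k' : 0 < i -> 0 < j -> ray i k = ray j k' -> i = j.
Proof.
move=> i0 j0; case E: (ray j k') => [n e] E'.
have [n2|] := leqP 2 n.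
  by have [_ _ <-] := ray_col i0 E' n2; have [_ _ <-] := ray_col j0 E n2.
case: k E' => [|k] [En Ee] lt; last first.
  by have [] := ray_vertex i0 (ltn0Sn k); rewrite En leqNgt lt.
case: k' E => [|k'] [En' Ee']; first by rewrite Ee Ee'.
by have [] := ray_vertex j0 (ltn0Sn k'); rewrite En' leqNgt lt.
Qed.

Definition girder_seq (n : nat) : seq (nat * nat) :=
  [seq (n, e) | e <- iota 0 (4 * n - 4)].

Lemma seq_arc_iota (T : Type) (g : nat -> T) a k x y :
  seq_arc [seq g e | e <- iota a k] x y <->
  exists e, [/\ a <= e, e.+1 < a + k, x = g e & y = g e.+1].
Proof.
split.
  elim: k a => [|k IH] a [s1 [s2 E]]; first by case: s1 E.
  case: s1 E => [|u s1] [].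
    case: k {IH} => // k <- [<- _]; exists a; split=> //; lia.
  move=> _ E; have [|e [ae ek -> ->]] := IH a.+1; first by exists s1, s2.
  by exists e; split=> //; lia.
case=> e [ae ek -> ->]; exists [seq g e | e <- iota a (e - a)].
exists [seq g e | e <- iota e.+2 (a + k - e.+2)].
have -> : k = (e - a) + (2 + (a + k - e.+2)) by lia.
rewrite iotaD map_cat subnKC //=; congr (_ ++ [:: _, _ & map g (iota _ _)]); lia.
Qed.

Lemma range_ray n e : 2 <= n -> e < 4 * n - 4 -> range (ray (col n (uphalf e))) (n, e).
Proof. by move=> n2 en; have [k [_ <- _]] := ray_surj n2 en; exists k. Qed.

Lemma ray_arc_girder n c : 2 <= n -> c.+1 < 2 * n - 2 ->
  ray_arc (ray (col n c.+1)) (n, (2 * c).+1) (n, (2 * c).+2).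
Proof.
move=> n2 cn; have [|k] := ray_surj (e := (2 * c).+1) n2; first lia.
have -> : uphalf (2 * c).+1 = c.+1 by lia.
by case=> _ Ek Ek'; exists k; rewrite Ek Ek' //; lia.
Qed.

(** Both staircases of the girder are instances, with [r = n - 2]: the first one starts at [c = 0],
    the second one at [c = n - 1]. *)
Lemma girder_stair n r c : 2 <= n -> c + r <= 2 * n - 3 ->
  staircase ray [seq col n x | x <- iota c r.+2]
                [seq (n, e) | e <- iota (2 * c) (2 * r).+2].
Proof.
move=> n2; have start c' : c' <= 2 * n - 3 -> range (ray (col n c')) (n, 2 * c').
  move=> cn; have {1}-> : c' = uphalf (2 * c') by lia.
  by apply: range_ray => //; lia.
have stop c' : c' <= 2 * n - 3 -> range (ray (col n c'.+1)) (n, (2 * c').+1).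
  move=> cn; have {1}-> : c'.+1 = uphalf (2 * c').+1 by lia.
  by apply: range_ray => //; lia.
elim: r c => [|r IH] c cr.
  by apply: staircase_edge; [apply: start|apply: stop]; lia.
have -> : (2 * r.+1).+2 = (2 * r).+4 by lia.
have IH' : staircase ray [seq col n x | x <- iota c.+1 r.+2]
    [seq (n, e) | e <- iota (2 * c).+2 (2 * r).+2].
  have -> : (2 * c).+2 = 2 * c.+1 by lia.
  by apply: IH; lia.
apply: staircase_step IH'; [apply: start|apply: stop|apply: ray_arc_girder]; lia.
Qed.

Lemma girder_girder n : 2 <= n -> girder Bidirected ray n (girder_seq n).
Proof.
move=> n2.
have E1 : rcons [seq (n, e) | e <- iota 0 (2 * n - 3)] (n, 2 * n - 3) =
    [seq (n, e) | e <- iota 0 (2 * n - 2)].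
  have -> : 2 * n - 2 = (2 * n - 3) + 1 by lia.
  by rewrite iotaD map_cat cats1.
have E2 : (n, 2 * n - 2) :: [seq (n, e) | e <- iota (2 * n - 1) (2 * n - 3)] =
    [seq (n, e) | e <- iota (2 * n - 2) (2 * n - 2)].
  have {3}-> : 2 * n - 2 = (2 * n - 3).+1 by lia.
  by rewrite /=; congr (_ :: map _ (iota _ _)); lia.
have Un a k : uniq [seq (n, e) | e <- iota a k].
  by rewrite map_inj_uniq ?iota_uniq // => e e' [].
exists [seq (n, e) | e <- iota 0 (2 * n - 3)], (n, 2 * n - 3), (n, 2 * n - 2).
exists [seq (n, e) | e <- iota (2 * n - 1) (2 * n - 3)]; rewrite E1 E2.
have sub : n = (n - 2).+2 by lia.
split.
- split=> //.
  have -> : 2 * n - 2 = (2 * (n - 2)).+2 by lia.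
  have -> : first_indices Bidirected n = [seq col n x | x <- iota 0 (n - 2).+2].
    rewrite -sub /=; apply: (@eq_from_nth _ 0); rewrite ?size_map ?size_iota // => i lin.
    rewrite (nth_map 0) ?size_iota // !nth_iota // /col; lia.
  by apply: (@girder_stair n (n - 2) 0); lia.
- have -> : 2 * n - 3 = (2 * (n - 2)).+1 by lia.
  have -> : 2 * n - 2 = (2 * (n - 2)).+2 by lia.
  have {1}-> : n = col n (n - 2).+1 by rewrite /col; lia.
  by apply: ray_arc_girder; lia.
- split=> //.
  have -> : 2 * n - 2 = 2 * (n - 1) by lia.
  have {2}-> : 2 * (n - 1) = (2 * (n - 2)).+2 by lia.
  have -> : second_indices Bidirected n = [seq col n x | x <- iota (n - 1) (n - 2).+2].
    rewrite -sub /=; apply: (@eq_from_nth _ 0).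
      by rewrite size_rev size_map !size_iota.
    move=> i; rewrite size_rev size_iota => lin.
    rewrite nth_rev ?size_iota // (nth_map 0) ?size_iota // !nth_iota // /col; lia.
  by apply: (@girder_stair n (n - 2) (n - 1)); lia.
- rewrite -subset0 => z [] /= /mapP[e]; rewrite mem_iota => en ->.
  case=> [/mapP[e']|[i [k [k' [i0 Ek kk' /= /mapP[e']]]]]]; rewrite mem_iota.
    by move=> en' [E]; lia.
  move=> en' Ek'; have [k0 _ _] := ray_col i0 (esym Ek) n2.
  move: kk'; rewrite leq_eqVlt => /predU1P[kk'|kk'].
    by move: Ek'; rewrite -kk' -Ek => -[E]; lia.
  (* No vertex of the second staircase precedes one of the first on a ray, because its level is
     larger. *)
  have := level_ray i0 k0 kk'; rewrite Ek' -Ek /level /=; lia.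
- rewrite -map_cat -iotaD /girder_seq; congr (map _ (iota _ _)); lia.
Qed.

Lemma girder_level n z : z \in girder_seq n -> n * n <= level z < n.+1 * n.+1.
Proof.
case/mapP=> e; rewrite mem_iota /level => en -> /=.
rewrite leq_addr mulSn mulnS; lia.
Qed.

(** * The quarter-grid as a digraph *)

Definition quarter_vert : set (nat * nat) :=
  [set v | (v.1 = 0 /\ 0 < v.2) \/ (2 <= v.1 /\ v.2 < 4 * v.1 - 4)].

Definition quarter_arc (x y : nat * nat) : Prop :=
  (exists2 i, 0 < i & ray_arc (ray i) x y)
  \/ (exists2 n, 2 <= n & seq_arc (girder_seq n) x y).

Lemma quarter_vert_ray i k : 0 < i -> quarter_vert (ray i k).
Proof.
case: k => [|k] i0; [by left|right].
by have [] := ray_vertex i0 (ltn0Sn k).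
Qed.

Lemma quarter_arc_vert x y : quarter_arc x y -> quarter_vert x /\ quarter_vert y.
Proof.
case=> [[i i0 [k [-> ->]]]|[n n2 /seq_arc_iota[e [_ en -> ->]]]].
  by split; apply: quarter_vert_ray.
by split; right => /=; lia.
Qed.

Lemma quarter_arc_loopless x : ~ quarter_arc x x.
Proof.
case=> [[i i0 [k [-> /(ray_inj i0)]]]|[n n2 /seq_arc_iota[e [_ _ -> []]]]]; lia.
Qed.

Definition quarter : digraph (nat * nat) :=
  Digraph (fun x y a => (quarter_arc_vert (x := x) (y := y) a).1)
          (fun x y a => (quarter_arc_vert a).2) quarter_arc_loopless.

Lemma quarter_quarter_grid : quarter_grid Bidirected quarter ray girder_seq.
Proof.
split.
- exact: ray_inj.
- move=> i j i0 j0 ij; rewrite -subset0 => z [[k _ <-] [k' _ /esym/(ray_disjoint i0 j0)]].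
  exact: ij.
- exact: girder_girder.
- move=> i n i2 lin; rewrite -subset0 => z [/= zn].
  (* Levels increase along rays, so apart from roots, which lie on no girder, the closure of girder
     [i] stays below this bound, and girder [n] does not. *)
  have lt : (i.+1 * i.+1 <= n * n) by apply: leq_mul.
  have /andP[zn1 _] := girder_level zn.
  case=> [/girder_level/andP[_]|[j [k [k' [j0 Ek kk' /girder_level/andP[_]]]]]].
    by rewrite ltnNge (leq_trans lt zn1).
  have k0 : 0 < k.
    have [e _ Ez] := mapP zn; rewrite Ez in Ek.
    by have [] := ray_col j0 (esym Ek); lia.
  rewrite ltnNge (leq_trans lt) // (leq_trans zn1) // Ek.
  by move: kk'; rewrite leq_eqVlt => /predU1P[->//|/(level_ray j0 k0)/ltnW].
- apply/seteqP; split=> [[a b] [[/= -> b0]|[/= a2 ba]]|z [[i i0 [k _ <-]]|[n n2]]].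
  + by left; exists b => //; exists 0.
  + by right; exists a => //=; apply/mapP; exists b; rewrite // mem_iota.
  + exact: quarter_vert_ray.
  + by move=> /mapP[e]; rewrite mem_iota => en ->; right.
- by [].
- move=> v vV [[u [uv uU]] [w [vw wU]]].
  case: vV => [[v1 v2]|[n2 en]].
    case: uv => [[i i0 [k [_ Ev]]]|[n n2 /seq_arc_iota[e [_ _ _ Ev]]]].
      rewrite Ev in v1; have := ray_vertex i0 (ltn0Sn k).
      by rewrite [ray_girder _ _]v1; case.
    by move: v1 n2; rewrite Ev /= => ->.
  case Ev: v n2 en => [n e] /= n2 en.
  have [k [k0 Ek _]] := ray_surj n2 en; set i := col n (uphalf e) in Ek.
  have i0 : 0 < i by rewrite /i /col; lia.
  (* A vertex of odd rank is entered along its ray and along a horizontal edge from another ray; one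
     of even rank is left in two such ways. *)
  have [oe|ee] := boolP (odd e).
    have a1 : quarter_arc (ray i k.-1) v.
      by left; exists i => //; exists k.-1; rewrite prednK // Ek.
    have a2 : quarter_arc (n, e.-1) v.
      right; exists n => //; apply/seq_arc_iota; exists e.-1.
      rewrite Ev; split=> //; [lia|].
      by congr pair; lia.
    have /esym/(ray_col i0)/(_ n2)[_ _] : (n, e.-1) = ray i k.-1.
      by rewrite -(uU _ a2); apply: uU.
    by rewrite /i /col; lia.
  have a1 : quarter_arc v (ray i k.+1).
    by left; exists i => //; exists k; rewrite Ek.
  have a2 : quarter_arc v (n, e.+1).
    by right; exists n => //; apply/seq_arc_iota; exists e; rewrite Ev; split=> //; lia.
  have /esym/(ray_col i0)/(_ n2)[_ _] : (n, e.+1) = ray i k.+1.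
    by rewrite -(wU _ a2); apply: wU.
  by rewrite /i /col; lia.
- move=> i n i0 n2; apply/negP => /mapP[e _ [E]]; lia.
Qed.

(** * The necklace grid *)

Lemma seq_arc2 (T : Type) (x y v w : T) : seq_arc [:: x; y] v w <-> v = x /\ w = y.
Proof.
split=> [[s1 [s2]]|[-> ->]]; last by exists [::], [::].
by case: s1 => [[-> -> _]|? [|? []]].
Qed.

Lemma trivial_subdivision (U : eqType) (Q : digraph U) :
  subdivision Q Q id (fun _ _ => [::]).
Proof.
split=> //.
- move=> x y xy; rewrite /= inE andbT; apply/eqP => E.
  by rewrite E in xy; apply: arc_loopless xy.
- move=> w; split=> [wQ|[[x Qx ->]//|[x [y [xy]]]]]; first by left; exists w.
  by rewrite !inE => /orP[] /eqP ->; [apply: arc_tail xy|apply: arc_head xy].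
- move=> v w; split=> [vw|[x [y [xy /seq_arc2[-> ->]]]]//].
  by exists v, w; split=> //; apply/seq_arc2.
Qed.

(** * Columns as necklaces *)

Section Induced.
Variable S : set cell.

Definition induced_arc (x y : cell) : Prop := [/\ S x, S y & adj x y].

Lemma induced_arc_tail x y : induced_arc x y -> S x. Proof. by case. Qed.

Lemma induced_arc_head x y : induced_arc x y -> S y. Proof. by case. Qed.

Lemma induced_arc_loopless x : ~ induced_arc x x.
Proof. by case=> _ _ /adj_neq; rewrite eqxx. Qed.

Definition induced : digraph cell :=
  Digraph induced_arc_tail induced_arc_head induced_arc_loopless.

Lemma path_seq_arc (T : Type) (e : rel T) x p u v :
  path e x p -> seq_arc (x :: p) u v -> e u v.
Proof.
move=> xp [s1 [s2 E]]; have : sorted e (x :: p) by [].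
by rewrite E => /cat_sorted2[_ /andP[]].
Qed.

Lemma seq_arc_mem2 (T : eqType) (s : seq T) x y : seq_arc s x y -> y \in s.
Proof. by case=> s1 [s2 ->]; rewrite mem_cat !inE eqxx !orbT. Qed.

Lemma induced_strong : (forall x y, S x -> S y -> conn S x y) ->
  strongly_connected induced.
Proof.
move=> C x y Sx Sy; have [p [xp <- Sp]] := C x y Sx Sy.
case/shortenP: xp => p' xp' Up' sp'; exists p' => //.
have Sp' u : u \in x :: p' -> S u.
  by rewrite inE => /predU1P[->//|/sp' up]; apply: Sp; rewrite inE up orbT.
split=> // u v uv; split; last exact: path_seq_arc uv.
  exact/Sp'/seq_arc_mem/uv.
exact/Sp'/seq_arc_mem2/uv.
Qed.

End Induced.

Definition column (i : nat) : set cell := [set z | z.1 = i /\ 0 < z.2].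
Definition block (i l : nat) : set cell := [set z | z.1 = i /\ l <= z.2 <= l.+1].

Lemma conn_vertical (S : set cell) i : (forall y y', S (i, y) -> S (i, y') ->
    forall k, y <= k <= y' -> S (i, k)) ->
  forall y y', S (i, y) -> S (i, y') -> conn S (i, y) (i, y').
Proof.
move=> convex; have up y d : S (i, y) -> S (i, y + d) -> conn S (i, y) (i, y + d).
  elim: d => [|d IH] Sy Syd; first by rewrite addn0; apply: conn_refl.
  have Sd : S (i, y + d) by apply: convex Sy Syd _ _; lia.
  apply: conn_trans (IH Sy Sd) (conn_cons Sd _ (conn_refl Syd)).
  by rewrite /adj /= addnS !eqxx.
move=> y y' Sy Sy'; have [yy'|/ltnW yy'] := leqP y y'.
  by rewrite -(subnKC yy') in Sy' *; apply: up.
by rewrite -(subnKC yy') in Sy *; apply/conn_sym/up.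
Qed.

Lemma column_strong i : strongly_connected (induced (column i)).
Proof.
apply: induced_strong => -[a b] [a' b'] [/= -> b0] [/= -> b'0].
by apply: conn_vertical => //= y y' [_ /= y0] _ k /andP[yk _]; split=> //=; lia.
Qed.

Lemma block_strong i l : strongly_connected (induced (block i l)).
Proof.
apply: induced_strong => -[a b] [a' b'] [/= -> b0] [/= -> b'0].
by apply: conn_vertical => //= y y' [_ /= y0] [_ /= y1] k yk; split=> //=; lia.
Qed.

Lemma column_witness i :
  necklace_witness (induced (column i)) (fun l => induced (block i l)).
Proof.
split.
- move=> l l0; have -> : vert (induced (block i l)) = [set` [:: (i, l); (i, l.+1)]].
    apply/seteqP; split=> -[a b] /=; rewrite !inE !xpair_eqE.
      by case=> /= ->; rewrite eqxx /=; lia.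
    by case/orP=> /andP[/eqP-> /eqP->]; split=> //=; lia.
  exact: finite_seq.
- by move=> l l0; apply: block_strong.
- apply/seteqP; split=> -[a b] /=.
    by case=> /= -> b0; exists b => //; split=> //=; rewrite leqnn leqnSn.
  by case=> l /= l0 [/= -> lb]; split=> //=; lia.
- move=> [a b] [a' b']; split.
    case=> -[/= -> b0] [/= -> b'0] ab; exists (minn b b'); first lia.
    have Eb : (b.+1 == b') || (b'.+1 == b) by move: ab; rewrite /adj /= eqxx /=; lia.
    by split; [split=> //=; lia|split=> //=; lia|].
  by case=> l l0 [[/= -> lb] [/= -> lb'] ab]; split; [split=> //=; lia|split=> //=; lia|].
- move=> l k l0 k0; split=> [[[a b] [[/= _ H] [/= _ H']]]|lk]; first lia.
  by exists (i, maxn l k); split; split=> //=; lia.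
Qed.

Lemma column_necklace i : necklace (induced (column i)).
Proof.
split; first exact: column_strong.
by exists (fun l => induced (block i l)); apply: column_witness.
Qed.

(* The point at which the horizontal edge ending in [v] meets its column.     *)
Definition place (v : nat * nat) : cell :=
  (col v.1 (uphalf v.2), (level v).*2.+1).

(** * Horizontal edges and the finished grid *)

Lemma horizontalP i j a b : horizontal quarter ray i j a b ->
  exists n c, [/\ 2 <= n, c < 2 * n - 2, a = (n, 2 * c), b = (n, (2 * c).+1) &
                  i = col n c /\ j = col n c.+1].
Proof.
case=> i0 j0 ij [[i' i'0 [k [-> ->]]]|[n n2 /seq_arc_iota[e [_ en -> ->]]]].
  case=> -[k1 _ /(ray_disjoint i0 i'0) E1] [k2 _ /(ray_disjoint j0 i'0) E2].
  by rewrite E1 E2 in ij.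
case=> -[k1 _ /(ray_col i0)/(_ n2)[_ _ E1]] [k2 _ /(ray_col j0)/(_ n2)[_ _ E2]].
exists n, (e %/ 2); have oe : odd e = false.
  by apply/negP => oe; apply: ij; rewrite -E1 -E2; congr col; lia.
split=> //; [lia|congr pair; lia|congr pair; lia|].
by rewrite -E1 -E2; split; congr col; lia.
Qed.

Lemma placeE n c : c < 2 * n - 2 ->
  place (n, 2 * c) = (col n c, (n * n + c).*2.+1) /\
  place (n, (2 * c).+1) = (col n c.+1, (n * n + c).*2.+1).
Proof. by move=> cn; rewrite /place /level /=; split; congr (col n _, _); lia. Qed.

Definition grid_vert : set cell := [set z |
  (exists2 i, 0 < i & column i z) \/
  (exists a b, is_horizontal quarter ray a b /\ z \in link (place a) [::] (place b))].

Definition grid_arc (x y : cell) : Prop :=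
  (exists2 i, 0 < i & induced_arc (column i) x y) \/
  (exists a b, is_horizontal quarter ray a b /\
     seq_arc (link (place a) [::] (place b)) x y).

Lemma is_horizontalP a b : is_horizontal quarter ray a b -> exists n c,
  [/\ 2 <= n, c < 2 * n - 2, a = (n, 2 * c), b = (n, (2 * c).+1) &
   place a = (col n c, (n * n + c).*2.+1) /\ place b = (col n c.+1, (n * n + c).*2.+1)].
Proof.
case=> i [j /horizontalP[n [c [n2 cn -> -> _]]]]; exists n, c; split=> //.
exact: placeE.
Qed.

Lemma grid_vert_positive z : grid_vert z -> positive z.
Proof.
rewrite /positive.
case=> [[i i0 [-> ->]]|[a [b [/is_horizontalP[n [c [n2 cn _ _ [-> ->]]]]]]]].
  by rewrite i0.
by rewrite !inE => /orP[] /eqP-> /=; rewrite /col; lia.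
Qed.

Lemma grid_arc_adj x y : grid_arc x y -> adj x y.
Proof.
case=> [[i i0 []//]|[a [b [/is_horizontalP[n [c [n2 cn _ _ [-> ->]]]]]]]].
by case/seq_arc2=> -> ->; rewrite /adj /= eqxx /col /=; lia.
Qed.

Lemma grid_arc_tail x y : grid_arc x y -> grid_vert x.
Proof.
case=> [[i i0 [ix _ _]]|[a [b [ab /seq_arc_mem xab]]]]; first by left; exists i.
by right; exists a, b.
Qed.

Lemma grid_arc_head x y : grid_arc x y -> grid_vert y.
Proof.
case=> [[i i0 [_ iy _]]|[a [b [ab /seq_arc_mem2 yab]]]]; first by left; exists i.
by right; exists a, b.
Qed.

Lemma grid_arc_loopless x : ~ grid_arc x x.
Proof. by move=> /grid_arc_adj /adj_neq; rewrite eqxx. Qed.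

Definition grid : digraph cell := Digraph grid_arc_tail grid_arc_head grid_arc_loopless.

(** An edge inside some column that touches column [i] is an edge of column [i], so only horizontal
    edges remain. *)
Lemma grid_arc_outside i x y : 0 < i -> grid_arc x y -> ~ induced_arc (column i) x y ->
  x.1 = i \/ y.1 = i -> exists n c, [/\ 2 <= n, c < 2 * n - 2 &
    x = (col n c, (n * n + c).*2.+1) /\ y = (col n c.+1, (n * n + c).*2.+1)].
Proof.
move=> i0 [[j j0 xy]|[a [b [/is_horizontalP[n [c [n2 cn _ _ [-> ->]]]] /seq_arc2 xy]]]].
  by move=> nxy; case=> E; case: nxy; case: (xy) => -[jx _] [jy _] _;
    rewrite -E ?jx ?jy.
by move=> _ _; exists n, c.
Qed.

Lemma ray_precedes i x y : 0 < i ->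
  sd_precedes id (fun _ _ => [::]) (ray i) x y ->
  exists k k', [/\ k < k', x = ray i k & y = ray i k'].
Proof.
move=> i0; elim=> {x y} [x y|x y z _ [k [k1 [kk1 -> ->]]] _ [k2 [k' [kk' E ->]]]].
  by case=> a [b [[k [-> ->]] /seq_arc2[-> ->]]]; exists k, k.+1.
by exists k, k'; rewrite (ltn_trans kk1) // (ray_inj i0 E).
Qed.

Lemma grid_replacement :
  necklace_replacement quarter ray id (fun _ _ => [::]) grid
    (fun i => induced (column i)) (fun i l => induced (block i l))
    (fun a _ => place a) (fun _ _ => [::]) (fun _ b => place b).
Proof.
split.
- by move=> i _; apply: column_necklace.
- by move=> i _; apply: column_witness.
- move=> i j _ _ ij; rewrite -subset0 => z [[/= Ei _] [/= Ej _]].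
  by apply: ij; rewrite -Ei -Ej.
- move=> i j a b /horizontalP[n [c [n2 cn -> -> [-> ->]]]].
  have [-> ->] := placeE cn; split=> //.
  by rewrite /= inE xpair_eqE andbT negb_and /col; apply/orP; left; lia.
- move=> a b a' b' z /is_horizontalP[n [c [n2 cn -> -> [-> ->]]]].
  move=> /is_horizontalP[n' [c' [n'2 c'n -> -> [-> ->]]]] zab zab'.
  have E : z.2 = (n * n + c).*2.+1 by move: zab; rewrite !inE => /orP[]/eqP->.
  have E' : z.2 = (n' * n' + c').*2.+1 by move: zab'; rewrite !inE => /orP[]/eqP->.
  have [-> ->] : n = n' /\ c = c' by apply: level_inj; lia.
  by [].
- by [].
- by [].
- move=> i l x y x' y' i0 ol xy nxy lxy xy' nxy' lxy'.
  have [|n [c [n2 cn [Ex Ey]]]] := grid_arc_outside i0 xy nxy.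
    by case: lxy => -[]; auto.
  have [|n' [c' [n'2 c'n [Ex' Ey']]]] := grid_arc_outside i0 xy' nxy'.
    by case: lxy' => -[]; auto.
  (* The block has heights [l] and [l.+1] with [l] odd, and the edge has odd height, so the height
     is [l]; it determines the edge by [level_inj]. *)
  have E : (n * n + c).*2.+1 = l.
    by move: lxy ol; rewrite Ex Ey => -[] [/= _]; lia.
  have E' : (n' * n' + c').*2.+1 = l.
    by move: lxy' ol; rewrite Ex' Ey' => -[] [/= _]; lia.
  have [En Ec] : n = n' /\ c = c' by apply: level_inj; lia.
  by rewrite Ex Ey Ex' Ey' En Ec.
- move=> i l x y i0 l0 _ _ _.
  (* Of the two vertices of a block, the lower one lies in the previous block and the upper one in
     the next. *)
  have empty z : ~ interior (fun l => induced (block i l)) l z.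
    case: z => a b [[/= zi lz] nz]; apply: nz.
    by have [bl|bl] := leqP b l; [left|right]; split=> //=; lia.
  by case=> /empty.
- move=> i x y x' y' i0 cx cy /(ray_precedes i0)[k [k' [kk' Ex Ey]]].
  have placed z z' : endpoints_correspond quarter ray id
      (fun a _ => place a) (fun _ b => place b) z z' ->
      z' = place z /\ 2 <= z.1.
    by case=> a [b [/is_horizontalP[n [c [n2 cn -> -> _]]]]] [[-> ->]|[-> ->]].
  have [-> x2] := placed _ _ cx; have [-> y2] := placed _ _ cy.
  have at_col z k1 : z = ray i k1 -> 2 <= z.1 -> 0 < k1 /\ (place z).1 = i.
    case: z => n e /esym /(ray_col i0) H n2; have [? _ ?] := H n2; by split.
  have [k0 cX] := at_col _ _ Ex x2; have [k'0 cY] := at_col _ _ Ey y2.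
  have lt := level_ray i0 k0 kk'; rewrite -Ex -Ey in lt.
  (* The heights of the two endpoints are odd and serve as the indices of their blocks. *)
  exists (level x).*2.+1, (level y).*2.+1; split; [lia|lia|lia| |].
    by split=> //=; rewrite leqnn leqnSn.
  by split=> //=; rewrite leqnn leqnSn.
Qed.

Theorem lemma7p2 :
  exists (T : eqType) (D : digraph T),
    bidirected_necklace_grid D /\
    ~ (exists D' : digraph T, subgraph D' D /\ cyclic_necklace_grid D').
Proof.
exists cell, grid; split.
  exists (nat * nat)%type, (nat * nat)%type, quarter, ray, girder_seq.
  exists quarter, id, (fun _ _ => [::]).
  split; [exact: quarter_quarter_grid|exact: trivial_subdivision|].
  exists (fun i => induced (column i)), (fun i l => induced (block i l)).
  exists (fun a _ => place a), (fun _ _ => [::]), (fun _ b => place b).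
  by apply: grid_replacement.
case=> D' [[sV sA]]; apply: grid_no_cyclic => [x y /sA|z /sV].
  exact: grid_arc_adj.
exact: grid_vert_positive.
Qed.
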